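(* Let $p\in(1,2]$ and let $H:\mathbb{R}^d\to\mathbb{R}^d$ be non-expansive in the Euclidean norm, i.e. $\|H(x)-H(y)\|\le\|x-y\|$ for all $x,y$. Assume the set $\mathcal X=\{x: H(x)=x\}$ of fixed points is nonempty and bounded. Consider $x_{k+1}=x_k+\alpha_k(H(x_k)-x_k+w_k)$ with $\mathcal F_k=\sigma(x_0,\dots,x_k)$, and suppose that $\mathbb{E}[w_k\mid\mathcal F_k]=0$ a.s. and that there exist a point $\bar x\in\mathcal X$ and constants $A>0$, $B\ge0$ with $\mathbb{E}[\|w_k\|^p\mid\mathcal F_k]\le A+B\|x_k-\bar x\|^p$ a.s. for all $k$. If $(\alpha_k)$ is a positive decreasing sequence with $\sum_k\alpha_k=\infty$ and $\sum_k\alpha_k^p<\infty$, then $x_k$ converges almost surely to a (possibly random) point of $\mathcal X$.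
   Context: $\|\cdot\|$ is the Euclidean norm; $x_0$ is an initial point and $w_k$ are integrable random noise vectors. *)

(* Defs.v *)
From HB Require Import structures.
From mathcomp Require Import all_boot all_order all_algebra.
From mathcomp Require Import all_classical all_reals all_analysis.
From mathcomp Require Import measurable_realfun.
Set Implicit Arguments. Unset Strict Implicit. Unset Printing Implicit Defensive.
Import Order.TTheory GRing.Theory Num.Theory.
Import numFieldNormedType.Exports.
Local Open Scope classical_set_scope.
Local Open Scope ring_scope.

Definition enorm (R : realType) (n : nat) (v : 'rV[R]_n) : R :=
  Num.sqrt (\sum_(i < n) (v ord0 i) ^+ 2).

Section CondExp.
Context (d : measure_display) (Omega : measurableType d) (R : realType)
  (P : probability Omega R).

(* sigma(x_0, ..., x_k): generated by the preimages of Borel sets under all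
   coordinates of x_0, ..., x_k (Borel sigma-algebra of R^n = product one) *)
Definition natural_filtration (n : nat) (x : nat -> Omega -> 'rV[R]_n) (k : nat)
  : set (set Omega) :=
  <<s [set A | exists j : nat, exists i : 'I_n, exists B : set R,
          (j <= k)%N /\ measurable B /\ A = (fun w => x j w ord0 i) @^-1` B] >>.

Definition is_cond_exp (G : set (set Omega)) (X Y : Omega -> R) : Prop :=
  (forall B : set R, measurable B -> G (Y @^-1` B)) /\
  P.-integrable setT (EFin \o X) /\ P.-integrable setT (EFin \o Y) /\
  (forall A, G A -> (\int[P]_(w in A) (X w)%:E = \int[P]_(w in A) (Y w)%:E)%E).

Definition is_cond_exp_nneg (G : set (set Omega)) (X : Omega -> R)
    (Y : Omega -> \bar R) : Prop :=
  (forall B : set (\bar R), measurable B -> G (Y @^-1` B)) /\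
  (forall w, (0 <= Y w)%E) /\
  (forall A, G A -> (\int[P]_(w in A) (X w)%:E = \int[P]_(w in A) Y w)%E).

End CondExp.

(* Main.v *)
(* Fix a fixed point y and use the Lyapunov function V_k = |x_k - y|^p.  The
   inequality |z + h|^p <= |z|^p + p |z|^(p-2) <z, h> + 6 |h|^p, valid for
   1 < p <= 2, together with |T_k x - y|^2 <= |x - y|^2 - a_k (1 - a_k) |H x - x|^2
   for the averaged map T_k = (1 - a_k) id + a_k H, makes V_k a nonnegative almost
   supermartingale with summable error a_k^p and decrease |x_k - y|^p - |T_k x_k - y|^p.
   Doob's upcrossing argument gives almost sure convergence of V_k and
   summability of the decrease, so sum_k a_k |H x_k - x_k|^2 is finite and
   |H x_k - x_k| is small infinitely often because sum_k a_k diverges.  A cluster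
   point z of x_k along such times is fixed by H; applying the convergence of
   |x_k - y| for y in a countable dense set of fixed points, with y close to z,
   yields x_k --> z. *)
Require Import Defs.
From HB Require Import structures.
From mathcomp Require Import all_boot all_order all_algebra.
From mathcomp Require Import all_classical all_reals all_analysis.
From mathcomp Require Import measurable_realfun.
From mathcomp Require Import finmap ring lra.
Import Order.TTheory GRing.Theory Num.Theory.
Import numFieldNormedType.Exports.
Local Open Scope classical_set_scope.
Local Open Scope ring_scope.

(** * Euclidean inner product and norm on row vectors, compared with the max norm *)

Section EuclideanNorm.
Context {R : realType} {n : nat}.
Implicit Types u v : 'rV[R]_n.

(** The noise has only a [p]-th moment, so for [p < 2] the squared distance has no usable drift and
    a [p]-th power takes its place. Non-expansiveness, however, yields a decrease of squares; it is
    converted into a decrease of [p]-th powers only along a path already known to be bounded. The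
    noise bound grows with the current distance, so the raw drift error is a multiple of [a_k^p]
    times an expectation of [V_k + 1]; a Gronwall bound on these expectations turns it into a
    deterministic summable error. Conditional expectations act only through integrals over events of
    the past: the gradient at [T_k x_k] is measurable for the past, hence orthogonal to the noise,
    and the events of the upcrossing strategy belong to the past. The null set outside which
    [|x_k - y|] converges depends on [y], while the limit point is random; this forces the passage
    through countably many fixed points. *)

Definition edot u v : R := \sum_(i < n) u ord0 i * v ord0 i.

Lemma enorm_ge0 u : 0 <= enorm u.
Proof. exact: sqrtr_ge0. Qed.

Lemma enorm_sqr u : enorm u ^+ 2 = edot u u.
Proof.
rewrite sqr_sqrtr; last by apply: sumr_ge0 => i _; exact: sqr_ge0.
by apply: eq_bigr => i _; rewrite expr2.
Qed.

Lemma edotC u v : edot u v = edot v u.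
Proof. by apply: eq_bigr => i _; rewrite mulrC. Qed.

Lemma edotZl a u v : edot (a *: u) v = a * edot u v.
Proof. by rewrite /edot mulr_sumr; apply: eq_bigr => i _; rewrite mxE mulrA. Qed.

Lemma enorm_sqrD u v :
  enorm (u + v) ^+ 2 = enorm u ^+ 2 + 2 * edot u v + enorm v ^+ 2.
Proof.
rewrite !enorm_sqr /edot mulr_sumr -!big_split /=.
by apply: eq_bigr => i _; rewrite !mxE; ring.
Qed.

Lemma enormZ a u : enorm (a *: u) = `|a| * enorm u.
Proof.
rewrite /enorm -[in RHS]sqrtr_sqr -sqrtrM ?sqr_ge0// mulr_sumr.
by congr Num.sqrt; apply: eq_bigr => i _; rewrite mxE exprMn.
Qed.

Lemma enormN u : enorm (- u) = enorm u.
Proof. by rewrite -scaleN1r enormZ normrN1 mul1r. Qed.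

Lemma enormC u v : enorm (u - v) = enorm (v - u).
Proof. by rewrite -enormN opprB. Qed.

Lemma enorm0 : enorm (0 : 'rV[R]_n) = 0.
Proof. by rewrite -(scale0r 0) enormZ normr0 mul0r. Qed.

Lemma enorm_eq0 u : enorm u = 0 -> u = 0.
Proof.
move=> /(congr1 (fun r => r ^+ 2)); rewrite expr0n/= enorm_sqr => /eqP.
rewrite psumr_eq0; last by move=> i _; rewrite -expr2 sqr_ge0.
move=> /allP u0; apply/rowP => i; rewrite mxE.
by have /= := u0 i (mem_index_enum _); rewrite mulf_eq0 orbb => /eqP.
Qed.

(** The squared norm of [v] minus its projection on [u] is nonnegative; clearing the denominator
    gives Cauchy-Schwarz. *)
Lemma edot_le u v : edot u v <= enorm u * enorm v.
Proof.
have [/enorm_eq0 ->|u0] := eqVneq (enorm u) 0.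
  by rewrite enorm0 mul0r -(scale0r 0) edotZl mul0r.
have {}u0 : 0 < enorm u by rewrite lt_neqAle eq_sym u0 enorm_ge0.
have := sqr_ge0 (enorm (v + (- (edot u v / enorm u ^+ 2)) *: u)).
rewrite enorm_sqrD enormZ exprMn real_normK ?num_real// edotC edotZl => h.
have := enorm_ge0 v => v0.
have [d0|d0] := leP (edot u v) 0; first by rewrite (le_trans d0)// mulr_ge0// ltW.
rewrite -(@ler_pXn2r _ 2) ?nnegrE ?(ltW d0) ?mulr_ge0 ?(ltW u0)//.
have e : enorm v ^+ 2 + 2 * (- (edot u v / enorm u ^+ 2) * edot u v) +
    (- (edot u v / enorm u ^+ 2)) ^+ 2 * enorm u ^+ 2 =
    enorm v ^+ 2 - edot u v ^+ 2 / enorm u ^+ 2 by field; rewrite gt_eqF.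
by move: h; rewrite e subr_ge0 ler_pdivrMr ?exprn_gt0// exprMn mulrC.
Qed.

Lemma edot_ge u v : - (enorm u * enorm v) <= edot u v.
Proof.
by have := edot_le (- u) v; rewrite enormN -scaleN1r edotZl mulN1r lerNl.
Qed.

Lemma enormD u v : enorm (u + v) <= enorm u + enorm v.
Proof.
rewrite -(@ler_pXn2r _ 2) ?nnegrE ?addr_ge0 ?enorm_ge0// enorm_sqrD.
by have := edot_le u v; nra.
Qed.

Lemma enormB_triangle u v t : enorm (u - t) <= enorm (u - v) + enorm (v - t).
Proof. by have := enormD (u - v) (v - t); rewrite addrA subrK. Qed.

Lemma coord_le_enorm u i : `|u ord0 i| <= enorm u.
Proof.
rewrite -sqrtr_sqr ler_sqrt ?sumr_ge0// => [|j _]; last exact: sqr_ge0.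
by rewrite (bigD1 i)//= lerDl sumr_ge0// => j _; exact: sqr_ge0.
Qed.

Lemma enorm_le_coord u e : 0 <= e -> (forall i, `|u ord0 i| <= e) ->
  enorm u <= n%:R * e.
Proof.
move=> e0 ue; rewrite -(@ler_pXn2r _ 2) ?nnegrE ?enorm_ge0 ?mulr_ge0//.
rewrite enorm_sqr (@le_trans _ _ (n%:R * e ^+ 2))//.
  rewrite mulr_natl -[X in _ *+ X](card_ord n) -sumr_const ler_sum// => i _.
  by rewrite -expr2 -real_normK ?num_real// lerXn2r ?nnegrE.
rewrite exprMn ler_wpM2r ?sqr_ge0//; case: (n) => [|m]; first by rewrite expr0n.
by rewrite expr2 ler_peMl// ler1n.
Qed.

Lemma norm_rowE u : `|u| = \big[Num.max/0]_ij `|u ij.1 ij.2|.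
Proof. exact: mx_normrE. Qed.

Lemma enorm_le_norm u : enorm u <= n%:R * `|u|.
Proof.
apply: enorm_le_coord => // i; rewrite norm_rowE.
by apply/bigmax_geP; right; exists (ord0, i).
Qed.

Lemma norm_le_enorm u : `|u| <= enorm u.
Proof.
rewrite norm_rowE; apply/bigmax_leP; split; first exact: enorm_ge0.
by move=> [i j] _/=; rewrite (ord1 i); exact: coord_le_enorm.
Qed.

Lemma rat_row_dense u e : 0 < e ->
  exists q : 'rV[rat]_n, enorm (u - map_mx ratr q) < e.
Proof.
(* [n.+1] keeps the division meaningful for [n = 0] and makes [n%:R * e'] strictly smaller than
   [e]. *)
move=> e0; pose e' := e / n.+1%:R.
have e'0 : 0 < e' by rewrite divr_gt0.
have /choice[q hq] : forall i, exists r : rat, `|u ord0 i - ratr r| <= e'.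
  move=> i; have : u ord0 i - e' < u ord0 i + e' by lra.
  move=> /rat_in_itvoo[r]; rewrite in_itv/= => /andP[r1 r2].
  by exists r; rewrite ler_distlC; apply/andP; split; lra.
exists (\row_i q i); apply: (@le_lt_trans _ _ (n%:R * e')).
  by apply: enorm_le_coord; [exact: ltW|move=> i; rewrite !mxE].
by rewrite mulrCA gtr_pMr// ltr_pdivrMr// mul1r ltr_nat.
Qed.

End EuclideanNorm.

(** * Decrease of the squared distance to a fixed point under the averaged map *)

Section AveragedMap.
Context {R : realType} {n : nat} (H : 'rV[R]_n -> 'rV[R]_n).
Hypothesis Hne : forall u v, enorm (H u - H v) <= enorm (u - v).

(** With [u = H x - x] and [v = x - y], non-expansiveness reads [|u + v|^2 <= |v|^2], that is
    [|u|^2 + 2 <u, v> <= 0]; [a] times this bounds the cross term of [|v + a u|^2]. *)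
Lemma averaged_sqr (a : R) x y : 0 <= a -> H y = y ->
  enorm (x + a *: (H x - x) - y) ^+ 2 <=
  enorm (x - y) ^+ 2 - a * (1 - a) * enorm (H x - x) ^+ 2.
Proof.
move=> a0 Hy.
have -> : x + a *: (H x - x) - y = (x - y) + a *: (H x - x).
  by rewrite addrAC.
rewrite (enorm_sqrD (x - y)) enormZ exprMn real_normK ?num_real// edotC edotZl.
have := Hne x y; rewrite Hy -(@ler_pXn2r _ 2) ?nnegrE ?enorm_ge0//.
have -> : H x - y = (H x - x) + (x - y) by rewrite addrA subrK.
rewrite (enorm_sqrD (H x - x) (x - y)) => h.
have : a * (enorm (H x - x) ^+ 2 + 2 * edot (H x - x) (x - y)) <= 0.
  by rewrite mulr_ge0_le0//; lra.
by lra.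
Qed.

End AveragedMap.

(** * Inequalities for real powers and the expansion of the [p]-th power of the norm *)

Section PowerInequalities.
Context {R : realType}.
Implicit Types p q s t h : R.

(** Writing [t = s * expR l], convexity of [expR] between [l] and [0] gives
    [expR (q * l) <= q * expR l + (1 - q)], which is the tangent bound after scaling. The value
    [t = 0] has no logarithm and is treated apart. *)
Lemma powR_tangent q s t : 0 <= q <= 1 -> 0 < s -> 0 <= t ->
  t `^ q <= s `^ q + q * s `^ (q - 1) * (t - s).
Proof.
move=> /andP[q0 q1] s0 t0.
have [->|qn0] := eqVneq q 0; first by rewrite !powRr0 mul0r mul0r addr0.
have {q0}qp : 0 < q by rewrite lt_neqAle eq_sym qn0.
have ss : s * s `^ (q - 1) = s `^ q by rewrite mulr_powRB1// ltW.
have s1 : 0 < s `^ (q - 1) by exact: powR_gt0.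
have [<-|tn0] := eqVneq 0 t.
  rewrite powR0// -ss; have := mulr_ge0 (mulr_ge0 (ltW s0) (ltW s1)) (_ : 0 <= 1 - q).
  by rewrite subr_ge0 => /(_ q1); lra.
have {tn0}tp : 0 < t by rewrite lt_neqAle tn0.
have h1 : 0 <= q <= 1 by rewrite ltW.
have := @convex_expR R (Itv01 (ltW qp) q1) (ln (t / s)) 0.
rewrite !convRE/= mulr0 addr0 expR0 mulr1 lnK ?posrE ?divr_gt0// => h.
have e : expR (q * ln (t / s)) * s `^ q = t `^ q.
  have -> : t `^ q = (t / s * s) `^ q by rewrite divfK// gt_eqF.
  rewrite powRM ?(ltW s0)//; last by rewrite ltW// divr_gt0.
  by congr (_ * _); rewrite /powR gt_eqF// divr_gt0.
have sq : 0 < s `^ q by exact: powR_gt0.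
rewrite -e; apply: (le_trans (ler_wpM2r (ltW sq) h)).
rewrite /unstable.onem -ss le_eqVlt; apply/orP; left; apply/eqP; field.
by rewrite gt_eqF.
Qed.

Lemma powR_sqrp s p : 0 <= s -> (s ^+ 2) `^ (p / 2) = s `^ p.
Proof.
move=> s0; rewrite -powR_mulrn// -powRrM; congr (_ `^ _).
by rewrite mulrC divfK.
Qed.

Lemma ler_powR_base p s t : 0 <= p -> 0 <= s -> s <= t -> s `^ p <= t `^ p.
Proof.
by move=> p0 s0 st; apply: ge0_ler_powR => //; rewrite nnegrE// (le_trans s0).
Qed.

Lemma powR2_le4 p : p <= 2 -> 2 `^ p <= 4 :> R.
Proof.
move=> p2; apply: (@le_trans _ _ (2 `^ 2)); first by apply: ler_powR => //; lra.
by rewrite powR_mulrn//; lra.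
Qed.

Lemma powRD_le4 p s t : 1 < p <= 2 -> 0 <= s -> 0 <= t ->
  (s + t) `^ p <= 4 * (s `^ p + t `^ p).
Proof.
move=> /andP[p1 p2] s0 t0; wlog st : s t s0 t0 / s <= t.
  by move=> ih; have [st|/ltW st] := leP s t; [exact: ih|rewrite addrC [X in _ * X]addrC ih].
have p0 : 0 <= p by lra.
apply: (@le_trans _ _ ((2 * t) `^ p)).
  by apply: ler_powR_base => //; lra.
rewrite powRM//; have := powR2_le4 p p2; have := powR_ge0 t p; have := powR_ge0 s p.
nra.
Qed.

(** Whichever of [s] and [t] is larger, its [p]-th power alone dominates the product. *)
Lemma powR_young p s t : 1 < p -> 0 <= s -> 0 <= t ->
  s `^ (p - 1) * t <= s `^ p + t `^ p.
Proof.
move=> p1 s0 t0; have p0 : 0 < p by lra.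
have p10 : 0 <= p - 1 by lra.
have [st|/ltW ts] := leP s t.
  apply: (@le_trans _ _ (t `^ p)); last by rewrite lerDr powR_ge0.
  by rewrite mulrC -[leRHS]mulr_powRB1// ler_wpM2l// ler_powR_base.
apply: (@le_trans _ _ (s `^ p)); last by rewrite lerDl powR_ge0.
by rewrite mulrC -[leRHS]mulr_powRB1// ler_wpM2r// powR_ge0.
Qed.

(** Bridge from the decrease of squares given by the averaged map to the decrease of the Lyapunov
    function. It combines [s^2 - t^2 <= 2 s (s - t)], [s^(p-1) (s - t) <= s^p - t^p] and
    [s = s^(2-p) s^(p-1)]; the bound [C] on the path controls [s^(2-p)]. *)
Lemma sqrB_le_powRB p s t C : 1 < p <= 2 -> 0 <= t -> t <= s -> s <= C ->
  s ^+ 2 - t ^+ 2 <= 2 * C `^ (2 - p) * (s `^ p - t `^ p).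
Proof.
move=> /andP[p1 p2] t0 ts sC.
have s0 : 0 <= s by exact: le_trans ts.
have p10 : 0 <= p - 1 by lra.
have sE := @mulr_powRB1 _ s p s0; have tE := @mulr_powRB1 _ t p t0.
have tp : t `^ p <= t * s `^ (p - 1).
  by rewrite -tE; [rewrite ler_wpM2l// ler_powR_base|lra].
have h1 : s `^ (p - 1) * (s - t) <= s `^ p - t `^ p.
  by rewrite -sE; [lra|lra].
have h2 : s `^ (2 - p) <= C `^ (2 - p) by apply: ler_powR_base => //; lra.
have h3 : s `^ (2 - p) * s `^ (p - 1) = s.
  rewrite -powRD; last by apply/implyP => /eqP; lra.
  by rewrite (_ : _ + _ = 1) ?powRr1//; lra.
apply: (@le_trans _ _ (2 * s * (s - t))); first by nra.
rewrite -{1}h3; apply: (@le_trans _ _ (2 * s `^ (2 - p) * (s `^ p - t `^ p))).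
  have := powR_ge0 s (2 - p); have := powR_ge0 s (p - 1); nra.
apply: ler_wpM2r; last by lra.
by apply: le_trans h1; rewrite mulr_ge0 ?powR_ge0// subr_ge0.
Qed.

(* At z = 0 the gradient term vanishes through z itself, whatever the value of
   0 `^ (p - 2). *)
Lemma enorm_powR_expand {n : nat} p (z h : 'rV[R]_n) : 1 < p <= 2 ->
  enorm (z + h) `^ p <=
  enorm z `^ p + p * enorm z `^ (p - 2) * edot z h + 6 * enorm h `^ p.
Proof.
move=> /andP[p1 p2]; have p0 : 0 < p by lra.
have [z0|zn0] := eqVneq (enorm z) 0.
  rewrite (enorm_eq0 _ z0) add0r enorm0 powR0 ?gt_eqF// add0r.
  have -> : edot 0 h = 0 by rewrite -(scale0r 0) edotZl mul0r.
  by rewrite mulr0 add0r ler_peMl ?powR_ge0//; lra.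
have s0 : 0 < enorm z by rewrite lt_neqAle eq_sym zn0 enorm_ge0.
have h0 := enorm_ge0 h.
have sE : enorm z * enorm z `^ (p - 2) = enorm z `^ (p - 1).
  have := @powRD R (enorm z) 1 (p - 2); rewrite zn0 implybT => /(_ isT).
  by rewrite powRr1 ?ltW// => <-; congr (_ `^ _); lra.
have sp : 0 < enorm z `^ (p - 2) by exact: powR_gt0.
(* Small increment: the tangent of the concave power [p / 2] at [|z|^2] is evaluated at [|z + h|^2].
   The quadratic remainder [|z|^(p-2) |h|^2] is at most [|h|^p] because [p - 2 <= 0]. *)
have [hs|sh] := leP (enorm h) (enorm z).
  rewrite -[leLHS]powR_sqrp ?enorm_ge0//.
  have q01 : 0 <= p / 2 <= 1 by apply/andP; split; lra.
  have := powR_tangent _ _ (enorm (z + h) ^+ 2) q01 (exprn_gt0 2 s0) (sqr_ge0 _).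
  move=> /le_trans; apply; rewrite powR_sqrp ?enorm_ge0//.
  have -> : (enorm z ^+ 2) `^ (p / 2 - 1) = enorm z `^ (p - 2).
    by rewrite -[RHS]powR_sqrp ?ltW//; congr (_ `^ _); lra.
  rewrite enorm_sqrD.
  have hh : enorm z `^ (p - 2) * enorm h ^+ 2 <= enorm h `^ p.
    have [->|hn0] := eqVneq (enorm h) 0; first by rewrite expr0n/= mulr0 powR_ge0.
    have hp : 0 < enorm h by rewrite lt_neqAle eq_sym hn0.
    have -> : enorm h `^ p = enorm h `^ (p - 2) * enorm h ^+ 2.
      rewrite -powR_mulrn// -powRD ?hn0 ?implybT//; congr (_ `^ _); lra.
    rewrite ler_wpM2r ?sqr_ge0//.
    have -> : p - 2 = - (2 - p) by lra.
    rewrite !powRN lef_pV2 ?posrE ?powR_gt0// ler_powR_base//; lra.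
  have := powR_ge0 (enorm h) p; nra.
(* Large increment: the left side is at most [4 |h|^p] and the gradient term at least [- p |h|^p],
   so the constant [6] comes from [4 + p] with [p <= 2]. *)
have p10 : 0 <= p - 1 by lra.
have zh : enorm (z + h) `^ p <= 4 * enorm h `^ p.
  apply: (@le_trans _ _ ((2 * enorm h) `^ p)).
    apply: ler_powR_base; rewrite ?enorm_ge0 ?(ltW p0)//.
    by apply: (le_trans (enormD _ _)); lra.
  by rewrite powRM// ler_wpM2r ?powR_ge0 ?powR2_le4.
have dh : - (enorm h `^ p) <= enorm z `^ (p - 2) * edot z h.
  apply: (@le_trans _ _ (enorm z `^ (p - 2) * - (enorm z * enorm h))).
    rewrite mulrN lerN2 mulrA [X in X * _]mulrC sE mulrC -[leRHS]mulr_powRB1//.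
    by rewrite ler_wpM2l// ler_powR_base// ltW.
  by rewrite ler_wpM2l ?edot_ge// ltW.
have := powR_ge0 (enorm h) p; have := powR_ge0 (enorm z) p; nra.
Qed.

End PowerInequalities.

(** * Upcrossings of a deterministic nonnegative sequence *)

Section UpcrossingPath.
Context {R : realType}.
Implicit Types (v : nat -> R) (a b : R).

(** Doob's buy-low, sell-high strategy along one path. The state at [k] depends on [v 0], ..., [v k]
    only, so it is known before the increment from [k] to [k.+1]. *)
Fixpoint holding v a b k : bool :=
  match k with
  | 0 => v 0%N <= a
  | k.+1 => if holding v a b k then v k.+1 < b else v k.+1 <= a
  end.

Definition crossing v a b k : bool := holding v a b k && (b <= v k.+1).

(* Buying at or below a and selling at or above b gains at least b - a per
   completed upcrossing; a pending position loses at most a since v >= 0. *)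
Lemma holding_gain v a b n : 0 <= a -> a <= b -> (forall k, 0 <= v k) ->
  \sum_(k < n) (holding v a b k)%:R * v k
    + (b - a) * \sum_(k < n) (crossing v a b k)%:R
    + (holding v a b n)%:R * v n
  <= \sum_(k < n) (holding v a b k)%:R * v k.+1 + (holding v a b n)%:R * a.
Proof.
move=> a0 ab v0; elim: n => [|n ih].
  rewrite !big_ord0 mulr0 !add0r /=.
  by have [|_] := leP (v 0%N) a; rewrite ?mul1r ?mul0r.
rewrite !big_ord_recr/= [crossing v a b n]/crossing.
have := v0 n.+1; have := v0 n.
move: ih; case: (holding v a b n) => /=.
  by have [|] := ltP (v n.+1) b; rewrite ?mulr1n ?mulr0n; lra.
by have [|] := leP (v n.+1) a; rewrite ?mulr1n ?mulr0n; lra.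
Qed.

(** After the last crossing, a position once open is never closed, which keeps the values below [b];
    if none is opened by a value at most [a], the values stay above [a]. *)
Lemma finite_crossing_dichotomy v a b :
  a < b -> (exists N, forall k, (N <= k)%N -> ~~ crossing v a b k) ->
  (exists N, forall k, (N <= k)%N -> a < v k) \/
  (exists N, forall k, (N <= k)%N -> v k < b).
Proof.
move=> ab [N hN]; case: (pselect (exists k, (N <= k)%N /\ v k <= a)); last first.
  move=> h; left; exists N => k Nk; rewrite ltNge; apply/negP => vk.
  by apply: h; exists k.
move=> [k [Nk vk]]; right; exists k => m km.
suff : holding v a b m && (v m < b) by case/andP.
elim: m km => [|m ih].
  by rewrite leqn0 => /eqP k0; move: vk; rewrite k0 /= => vk; rewrite vk (le_lt_trans vk ab).
rewrite leq_eqVlt => /predU1P[<-|].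
  rewrite (le_lt_trans vk ab) andbT; case: (k) vk => //= k' vk.
  by case: ifP => // _; exact: le_lt_trans vk ab.
rewrite ltnS => km; have /andP[hm _] := ih km.
have := hN m (leq_trans Nk km); rewrite /crossing hm/= -ltNge => vb.
by rewrite /= hm vb.
Qed.

(** The dichotomy is applied to rational levels only. The recurrent bound [c] excludes divergence to
    infinity: a rational level above [c] cannot be exceeded eventually, so an eventual upper bound
    exists. *)
Lemma cvgn_of_finite_crossings v : (forall k, 0 <= v k) ->
  (exists c : R, forall N, exists2 k, (N <= k)%N & v k <= c) ->
  (forall q r : rat, 0 <= (ratr q : R) -> (ratr q : R) < ratr r ->
     exists N, forall k, (N <= k)%N -> ~~ crossing v (ratr q) (ratr r) k) ->
  cvgn v.
Proof.
move=> v0 [c hc] hcr.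
(* The infimum of [S], the set of strict eventual upper bounds, is the upper limit of [v]. A
   rational [r] below it is not in [S], so the dichotomy puts [v] eventually above any rational
   [q < r]. *)
pose S := [set t : R | exists N, forall k, (N <= k)%N -> v k < t].
have S0 : lbound S 0.
  by move=> t [N hN]; apply: ltW; apply: le_lt_trans (hN N _).
have hS : has_inf S.
  split; last by exists 0.
  have : Num.max c 0 < Num.max c 0 + 1 by lra.
  move=> /rat_in_itvoo[q]; rewrite in_itv/= gt_max => /andP[/andP[cq q0] _].
  have : (ratr q : R) < ratr q + 1 by lra.
  move=> /rat_in_itvoo[r]; rewrite in_itv/= => /andP[qr _].
  exists (ratr r).
  case: (finite_crossing_dichotomy _ _ _ qr (hcr q r (ltW q0) qr)) => // -[N hN].
  have [k Nk vk] := hc N; have := hN k Nk; have := lt_le_trans cq (lexx _); lra.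
apply/cvg_ex; exists (inf S); apply/cvgrPdist_lt => e e0.
have [t [N1 h1] te] := inf_adherent e0 hS.
have [N2 h2] : exists N, forall k, (N <= k)%N -> inf S - e < v k.
  have : inf S - e < inf S by lra.
  move=> /rat_in_itvoo[q]; rewrite in_itv/= => /andP[eq qS].
  move: (qS) => /rat_in_itvoo[r]; rewrite in_itv/= => /andP[qr rS].
  have [q0|q0] := ltP (ratr q : R) 0.
    by exists 0%N => k _; have := v0 k; lra.
  case: (finite_crossing_dichotomy _ _ _ qr (hcr q r q0 qr)) => [[N hN]|rS'].
    by exists N => k Nk; exact: lt_trans (hN k Nk).
  have : inf S <= ratr r by apply: ge_inf => //; exists 0.
  by rewrite leNgt rS.
exists (maxn N1 N2) => // k /=; rewrite geq_max => /andP[k1 k2].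
have := h1 k k1; have := h2 k k2; rewrite ltr_distlC => ? ?.
by apply/andP; split; lra.
Qed.

End UpcrossingPath.

(** * Deterministic convergence of one path from the convergence of its distances *)

Section PathwiseConvergence.
Context {R : realType} {n : nat} (p : R) (H : 'rV[R]_n -> 'rV[R]_n).
Hypothesis p12 : 1 < p <= 2.
Hypothesis Hne : forall u v, enorm (H u - H v) <= enorm (u - v).

Lemma powR_cvg_bounded (x : nat -> 'rV[R]_n) (y : 'rV[R]_n) :
  cvgn (fun k => enorm (x k - y) `^ p) -> exists C : R, forall k, enorm (x k - y) <= C.
Proof.
(* [M + 1] bounds the [p]-th powers, hence is nonnegative; so [M + 2] also covers distances below
   [1], which exceed their [p]-th powers. *)
move=> /cvg_seq_bounded[M [_ hM]]; exists (M + 2) => k.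
have := hM (M + 1) _ k I; rewrite ltrDl ltr01 => /(_ isT)/=.
rewrite ger0_norm ?powR_ge0// => h.
have p1 : 1 <= p by case/andP: p12 => /ltW.
have [x1|x1] := leP 1 (enorm (x k - y)).
  by have := le1r_powR x1 p1; lra.
have := powR_ge0 (enorm (x k - y)) p; lra.
Qed.

(** If the residual stayed at least [e] from [N] on, each decrease would be at least a fixed
    multiple of [alpha k], and the bounded sum of decreases would bound the series of [alpha]. *)
Lemma asymptotic_regularity (x : nat -> 'rV[R]_n) (alpha : nat -> R) (y : 'rV[R]_n) :
  H y = y -> (forall k, 0 < alpha k) -> alpha @ \oo --> 0 ->
  series alpha @ \oo --> +oo ->
  cvgn (fun k => enorm (x k - y) `^ p) ->
  (exists C : R, forall m, \sum_(k < m) (enorm (x k - y) `^ p -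
     enorm (x k + alpha k *: (H (x k) - x k) - y) `^ p) <= C) ->
  forall (e : R) N, 0 < e -> exists2 k, (N <= k)%N & enorm (H (x k) - x k) < e.
Proof.
move=> Hy a0 acvg asum vcvg [C hC] e N e0; apply: contrapT => hno.
have [C0 hC0] := powR_cvg_bounded _ _ vcvg.
have [N1 _ hN1] : \forall k \near \oo, alpha k < 2^-1.
  have /cvgrPdist_lt/(_ (2^-1)) := acvg; rewrite invr_gt0 ltr0n => /(_ isT).
  by apply: filterS => k; rewrite sub0r normrN gtr0_norm.
pose U k := enorm (x k - y) `^ p -
     enorm (x k + alpha k *: (H (x k) - x k) - y) `^ p.
pose K := 2 * C0 `^ (2 - p).
have K0 : 0 <= K by rewrite mulr_ge0 ?powR_ge0.
(* The [2] is the bound [1 - alpha k > 1 / 2], valid from [N1] on. Past [maxn N N1] the terms [d k]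
   are nonpositive, so the initial ones bound all partial sums. *)
pose d k := alpha k * (e ^+ 2 / 2) - K * U k.
have hd k : (maxn N N1 <= k)%N -> d k <= 0.
  rewrite geq_max => /andP[Nk N1k]; rewrite subr_le0.
  have := hN1 k N1k => /= ak; have := a0 k => ak0.
  have avg := averaged_sqr H Hne (alpha k) (x k) y (ltW ak0) Hy.
  have er : e <= enorm (H (x k) - x k).
    by rewrite leNgt; apply/negP => ?; apply: hno; exists k.
  have : enorm (x k + alpha k *: (H (x k) - x k) - y) <= enorm (x k - y).
    rewrite -(@ler_pXn2r _ 2) ?nnegrE ?enorm_ge0//; apply: (le_trans avg).
    by rewrite gerBl !mulr_ge0 ?sqr_ge0//; lra.
  move=> /(sqrB_le_powRB p _ _ C0 p12 (enorm_ge0 _))/(_ (hC0 k)) h.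
  apply: le_trans h; apply: (@le_trans _ _ (alpha k * (1 - alpha k) * enorm (H (x k) - x k) ^+ 2)); last by lra.
  have e2 : e ^+ 2 <= enorm (H (x k) - x k) ^+ 2.
    by rewrite ler_pXn2r ?nnegrE ?enorm_ge0// ltW.
  have := sqr_ge0 e => ?.
  by rewrite -mulrA ler_wpM2l ?(ltW ak0)//; nra.
have [B hB] : exists B : R, forall m, \sum_(k < m) d k <= B.
  exists (\sum_(k < maxn N N1) `|d k|) => m.
  have [mM|/ltnW Mm] := leqP m (maxn N N1).
    rewrite !(big_ord_widen _ _ mM) [leRHS](bigID (fun i : 'I__ => (i < m)%N))/=.
    rewrite -[leLHS]addr0 lerD ?sumr_ge0//.
    by apply: ler_sum => i _; exact: ler_norm.
  rewrite -(big_mkord xpredT) -(big_mkord xpredT (fun k => `|d k|)).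
  rewrite (big_cat_nat (n := maxn N N1))//= -[leRHS]addr0 lerD//.
    by apply: ler_sum => i _; exact: ler_norm.
  rewrite big_nat_cond; apply: sumr_le0 => i /andP[/andP[? _] _]; exact: hd.
have h2 m : series alpha m * (e ^+ 2 / 2) <= B + K * C.
  rewrite /series/= big_mkord mulr_suml.
  have -> : \sum_(i < m) alpha i * (e ^+ 2 / 2) = \sum_(k < m) d k + K * \sum_(k < m) U k.
    by rewrite mulr_sumr -big_split/=; apply: eq_bigr => i _; rewrite /d; ring.
  by rewrite lerD// ler_wpM2l// hC.
have e20 : 0 < e ^+ 2 / 2 by rewrite divr_gt0 ?exprn_gt0.
have [m _ hm] : \forall m \near \oo, (B + K * C) / (e ^+ 2 / 2) + 1 <= series alpha m.
  by move/cvgryPge : asum; exact.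
have := h2 m; rewrite -ler_pdivlMr// => /(le_trans (hm m (leqnn m))).
by rewrite gerDl leNgt ltr01.
Qed.

Lemma averaged_path_cvg (x : nat -> 'rV[R]_n) (alpha : nat -> R)
    (D : set 'rV[R]_n) :
  (exists y, H y = y) ->
  (forall k, 0 < alpha k) -> alpha @ \oo --> 0 -> series alpha @ \oo --> +oo ->
  (forall y, D y -> H y = y) ->
  (forall y (e : R), H y = y -> 0 < e -> exists2 z, D z & enorm (y - z) < e) ->
  (forall y, D y -> cvgn (fun k => enorm (x k - y) `^ p)) ->
  (forall y, D y -> exists C : R, forall m, \sum_(k < m) (enorm (x k - y) `^ p -
     enorm (x k + alpha k *: (H (x k) - x k) - y) `^ p) <= C) ->
  exists z, H z = z /\ x @ \oo --> z.
Proof.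
move=> [y0 Hy0] a0 acvg asum DH Ddense Dcvg DU.
have [y Dy _] := Ddense y0 1 Hy0 ltr01.
have reg := asymptotic_regularity x alpha y (DH y Dy) a0 acvg asum (Dcvg y Dy) (DU y Dy).
have [C hC] := powR_cvg_bounded _ _ (Dcvg y Dy).
have /choice[s hs] : forall j, exists k, (j <= k)%N /\ enorm (H (x k) - x k) < j.+1%:R^-1.
  by move=> j; have [|k jk hk] := reg j.+1%:R^-1 j; [rewrite invr_gt0|exists k].
pose u := x \o s; pose B := C + enorm y.
have uB j i : `[- B, B]%classic (u j ord0 i).
  rewrite /= in_itv/= -ler_norml (le_trans (coord_le_enorm _ _))//.
  have := enormD (x (s j) - y) y; rewrite subrK => /le_trans; apply.
  by rewrite lerD.
have cK : compact [set v : 'rV[R]_n | forall i, `[- B, B]%classic (v ord0 i)].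
  by apply: (@rV_compact _ _ (fun=> `[- B, B]%classic)) => i; exact: segment_compact.
have [z [_ zcl]] := cK (u @ \oo) _ (filterE _ uB).
have near_z (e : R) N : 0 < e -> exists2 j, (N <= j)%N & enorm (u j - z) < e.
  (* [ball] refers to the max norm, which is within a factor [n] of [enorm]. *)
  move=> e0; have e1 : 0 < e / n.+1%:R by rewrite divr_gt0.
  have [||] := zcl (u @` [set j | (N <= j)%N]) (ball z (e / n.+1%:R)).
  - by exists N => // j Nj; exists j.
  - exact: nbhsx_ballx.
  - move=> _ [[j Nj <-]]; rewrite -ball_normE/= => zu; exists j => //.
    rewrite enormC; apply: (le_lt_trans (enorm_le_norm _)).
    apply: (@le_lt_trans _ _ (n%:R * (e / n.+1%:R))).
      by rewrite ler_wpM2l// ltW.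
    by rewrite mulrCA gtr_pMr// ltr_pdivrMr// mul1r ltr_nat.
have Hz : H z = z.
  apply/eqP; rewrite -subr_eq0; apply/eqP/enorm_eq0/eqP.
  rewrite eq_le enorm_ge0 andbT; apply/ler_addgt0Pr => e e0; rewrite add0r.
  have e3 : 0 < e / 3 by rewrite divr_gt0.
  have [N hN] : exists N, N.+1%:R^-1 < e / 3.
    have [N _ /(_ N (leqnn N)) /= hN] := near_infty_natSinv_lt (PosNum e3).
    by exists N.
  have [j Nj hj] := near_z (e / 3) N e3.
  have [_ hsj] := hs j.
  have h1 : enorm (H (u j) - u j) < e / 3.
    apply: (lt_trans hsj); apply: le_lt_trans hN.
    by rewrite lef_pV2 ?posrE// ler_nat.
  have := enormB_triangle (H z) (H (u j)) z.
  have := enormB_triangle (H (u j)) (u j) z.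
  have := Hne z (u j); rewrite (enormC z); lra.
exists z; split => //; apply/cvgrPdist_lt => e e0.
have e2 : 0 < e / 2 by rewrite divr_gt0.
(* Convergence of the distance is available at points of [D] only, so [t] stands in for [z]; both
   [|x k - t|] and [|t - z|] end below [e / 2]. *)
have [t Dt zt] := Ddense z (e / 2) Hz e2.
have p0 : 0 < p by case/andP: p12 => + _; exact/lt_trans/ltr01.
have /cvg_ex[L hL] := Dcvg t Dt.
have LE : L < (e / 2) `^ p.
  (* Half the gap: infinitely often the path is within [g] of [z], so the limit [L] cannot exceed
     the [p]-th power of [|z - t| + g]. *)
  pose g := (e / 2 - enorm (z - t)) / 2.
  have g0 : 0 < g by rewrite divr_gt0// subr_gt0.
  apply: (@le_lt_trans _ _ ((enorm (z - t) + g) `^ p)); last first.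
    by apply: gt0_ltr_powR; rewrite ?nnegrE ?addr_ge0 ?enorm_ge0 ?ltW// /g; lra.
  rewrite leNgt; apply/negP => gL.
  move/cvgr_gt : hL => /(_ _ gL) [N _ hN].
  have [j Nj hj] := near_z g N g0.
  have [jsj _] := hs j; have := hN (s j) (leq_trans Nj jsj); apply/negP.
  rewrite -leNgt/=; apply: ler_powR_base; rewrite ?enorm_ge0 ?ltW//.
  by have := enormB_triangle (u j) z t; rewrite /u/=; lra.
move/cvgr_lt : hL => /(_ _ LE); apply: filterS => k hk.
have {}hk : enorm (x k - t) < e / 2.
  rewrite ltNge; apply/negP => ek; move: hk; apply/negP; rewrite -leNgt.
  exact: ler_powR_base (ltW p0) (ltW e2) ek.
apply: (le_lt_trans (norm_le_enorm _)); rewrite enormC.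
have := enormB_triangle (x k) t z; rewrite (enormC t); lra.
Qed.

End PathwiseConvergence.

(** * Orthogonality of centred noise to variables of the past *)

Section SubSigmaAlgebra.
Context {d : measure_display} {T : measurableType d} (gen : set (set T)).
Hypothesis gen_sub : <<s gen >> `<=` measurable.

Lemma sub_measurable_fun d' (T' : measurableType d') (f : T -> T') :
  measurable_fun setT (f : g_sigma_algebraType gen -> T') -> measurable_fun setT f.
Proof. by move=> mf _ B mB; apply: gen_sub; exact: mf. Qed.

Context {R : realType} (mu : {measure set T -> \bar R}).
Variable w : T -> R.
Hypothesis iw : mu.-integrable setT (EFin \o w).
Hypothesis w0 : forall B, <<s gen >> B -> (\int[mu]_(t in B) (w t)%:E = 0)%E.

Let mw : measurable_fun setT w.
Proof. by apply/measurable_EFinP; case/integrableP: iw. Qed.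

Import HBNNSimple.

(** The level sets of a simple function lie in the sub-sigma-algebra, and [w] integrates to zero
    over each of them. *)
Let nnsfun_orthogonal (g : {nnsfun g_sigma_algebraType gen >-> R}) :
  (\int[mu]_t (g t * w t)%:E = 0)%E.
Proof.
pose A y : set T := g @^-1` [set y].
have mA y : <<s gen >> (A y).
  exact: (@measurable_funPTI _ _ _ _ g _ (measurable_set1 y)).
have patchw y : (fun t => (w t * \1_(A y) t)%:E) = (EFin \o w) \_ (A y).
  apply/funext => t; rewrite patchE indicE; case: ifPn => tA /=.
    by rewrite mulr1.
  by rewrite mulr0.
have iA y : mu.-integrable setT (fun t => (w t * \1_(A y) t)%:E).
  rewrite patchw -integrable_mkcond; last exact: gen_sub.
  by apply: integrableS iw => //; exact: gen_sub.
have gE t : (g t * w t)%:E =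
    (\sum_(y <- fset_set (range g)) (y%:E * (w t * \1_(A y) t)%:E))%E.
  rewrite fimfunE fsbig_finite//= mulr_suml -sumEFin.
  by apply: eq_bigr => y _; rewrite -EFinM -mulrA (mulrC (w t)).
under eq_integral => t _ do rewrite gE.
rewrite integral_sum//; last by move=> y; exact: integrableZl.
by rewrite big1// => y _; rewrite integralZl// patchw -integral_mkcond w0 ?mule0.
Qed.

(** Dominated convergence along simple approximations from below; [|f w|], integrable by assumption,
    is the dominating function. *)
Let ge0_orthogonal (f : T -> R) : (forall t, 0 <= f t) ->
  measurable_fun setT (f : g_sigma_algebraType gen -> R) ->
  mu.-integrable setT (fun t => (f t * w t)%:E) ->
  (\int[mu]_t (f t * w t)%:E = 0)%E.
Proof.
move=> f0 mf ifw.
have mEf : measurable_fun setT (EFin \o f : g_sigma_algebraType gen -> \bar R).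
  exact/measurable_EFinP.
pose g := nnsfun_approx measurableT mEf.
have gle k t : g k t <= f t.
  rewrite -lee_fin nnsfun_approxE; apply: (@le_approx _ _ _ setT) => //.
  by move=> ? _; rewrite lee_fin.
have gcvg t : (g k t)%:E @[k --> \oo] --> (f t)%:E.
  by apply: (@cvg_nnsfun_approx _ _ _ setT) => // ? _; rewrite lee_fin.
have [|||||_ _] := @dominated_convergence _ _ _ mu setT measurableT
    (fun k t => (g k t * w t)%:E) (fun t => (f t * w t)%:E)
    (abse \o (fun t => (f t * w t)%:E)).
- move=> k; apply/measurable_EFinP/measurable_funM => //.
  by apply: sub_measurable_fun; exact: measurable_funPT.
- by case/integrableP: ifw.
- apply: aeW => t _; apply: cvg_EFin; first exact: nearW.
  apply: cvgMl; have /fine_cvgP[_] := gcvg t; exact.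
- exact: integrable_abse.
- apply: aeW => t k _ /=; rewrite lee_fin !normrM ler_wpM2r//.
  by rewrite !ger0_norm//; exact: fun_ge0.
- move=> h; apply/esym; move: h; rewrite /sequence.
  under eq_fun do rewrite nnsfun_orthogonal.
  by move=> /(cvg_unique _ (cvg_cst _)); apply.
Qed.

(** Replaces the pull-out rule for conditional expectations: a factor known from the past does not
    disturb a vanishing conditional mean. Positive and negative parts of [f] reduce to the
    nonnegative case. *)
Lemma integral_orthogonal (f : T -> R) :
  measurable_fun setT (f : g_sigma_algebraType gen -> R) ->
  mu.-integrable setT (fun t => (f t * w t)%:E) ->
  (\int[mu]_t (f t * w t)%:E = 0)%E.
Proof.
move=> mf ifw.
have ipos : mu.-integrable setT (fun t => (f^\+ t * w t)%:E).
  apply: le_integrable ifw => //.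
    apply/measurable_EFinP/measurable_funM => //; apply: sub_measurable_fun.
    exact: measurable_funrpos.
  move=> t _ /=; rewrite lee_fin !normrM ler_wpM2r//.
  by rewrite /funrpos; case: (leP (f t) 0) => h; rewrite ?normr0.
have ineg : mu.-integrable setT (fun t => (f^\- t * w t)%:E).
  apply: le_integrable ifw => //.
    apply/measurable_EFinP/measurable_funM => //; apply: sub_measurable_fun.
    exact: measurable_funrneg.
  move=> t _ /=; rewrite lee_fin !normrM ler_wpM2r//.
  by rewrite /funrneg; case: (leP (- f t) 0) => h; rewrite ?normr0 ?normrN.
have fE t : (f t * w t)%:E = ((f^\+ t * w t)%:E - (f^\- t * w t)%:E)%E.
  by rewrite -EFinB -mulrBl -{1}(funrposBneg f).
under eq_integral do rewrite fE.
rewrite integralB// !ge0_orthogonal ?sube0//.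
- exact: measurable_funrneg.
- exact: measurable_funrpos.
Qed.

End SubSigmaAlgebra.

(** [h] is the infimum over rational [q] of the cones [h q + enorm (_ - q)], so [h (X t) < r] is a
    countable union of conditions on the coordinates of [X]. It serves both the norm and the
    coordinates of [H]. *)
Lemma measurable_lipschitz_comp (R : realType) (n : nat) (d : measure_display)
    (T : measurableType d) (X : T -> 'rV[R]_n) (h : 'rV[R]_n -> R) :
  (forall i, measurable_fun setT (fun t => X t ord0 i)) ->
  (forall u v, h u - h v <= enorm (u - v)) ->
  measurable_fun setT (fun t => h (X t)).
Proof.
move=> mX hL.
have mE q : measurable_fun setT (fun t => enorm (X t - q)).
  rewrite /enorm; apply: measurableT_comp => //.
    by apply: continuous_measurable_fun; exact: sqrt_continuous.
  apply: measurable_sum => i; apply: measurable_funX.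
  under eq_fun do rewrite !mxE.
  exact: measurable_funB.
apply: (measurability _ (RGenInftyO.measurableE R)) => //.
move=> /= _ [_ [r ->] <-]; rewrite setTI.
rewrite (_ : _ @^-1` _ = \bigcup_(q in [set: 'rV[rat]_n])
  [set t | h (map_mx ratr q) + enorm (X t - map_mx ratr q) < r]).
  apply: countable_bigcupT_measurable => [|q]; first exact: countableP.
  rewrite -[X in measurable X]setTI -preimage_true.
  apply: measurable_fun_ltr => //.
  exact: measurable_funD.
apply/seteqP; split => t /=.
  rewrite in_itv/= => hr.
  have e0 : 0 < (r - h (X t)) / 2 by rewrite divr_gt0// subr_gt0.
  have [q hq] := rat_row_dense (X t) _ e0.
  exists q => //=.
  have := hL (map_mx ratr q) (X t); rewrite (enormC (map_mx ratr q)); lra.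
move=> [q _ /=]; rewrite in_itv/=.
by have := hL (X t) (map_mx ratr q); lra.
Qed.

Lemma ae_forall_countType d (T : measurableType d) (R : realType)
    (mu : {measure set T -> \bar R}) (I : countType) (Q : I -> T -> Prop) :
  (forall i, {ae mu, forall t, Q i t}) -> {ae mu, forall t i, Q i t}.
Proof.
move=> hQ; have : {ae mu, forall t (k : nat), if choice.unpickle k is Some i then Q i t else True}.
  apply: ae_foralln => k; case: (choice.unpickle k) => [i|]; first exact: hQ.
  exact: aeW.
by apply: filterS => t ht i; have := ht (choice.pickle i); rewrite choice.pickleK.
Qed.

(** * Almost sure convergence of nonnegative almost supermartingales *)

Section AlmostSupermartingale.
Context {d : measure_display} {T : measurableType d} {R : realType}.
Variables (P : probability T R) (gen : nat -> set (set T)).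
Hypothesis gen_mono : forall k, <<s gen k >> `<=` <<s gen k.+1 >>.
Hypothesis gen_sub : forall k, <<s gen k >> `<=` measurable.
Variables (V U : nat -> T -> R) (e : nat -> R) (E : R).
Hypothesis V0 : forall k t, 0 <= V k t.
Hypothesis U0 : forall k t, 0 <= U k t.
Hypothesis mV : forall k,
  measurable_fun setT (V k : g_sigma_algebraType (gen k) -> R).
Hypothesis mU : forall k, measurable_fun setT (U k).
Hypothesis V0fin : (\int[P]_t (V 0%N t)%:E < +oo)%E.
Hypothesis eE : forall n, \sum_(k < n) e k <= E.
Hypothesis drift : forall k A, <<s gen k >> A ->
  (\int[P]_(t in A) (V k.+1 t)%:E + \int[P]_(t in A) (U k t)%:E <=
   \int[P]_(t in A) (V k t)%:E + (e k)%:E)%E.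

Let mVT k : measurable_fun setT (V k).
Proof. exact: (sub_measurable_fun _ (gen_sub k)). Qed.

Let mVE D k : measurable_fun D (fun t => (V k t)%:E).
Proof. by apply/measurable_EFinP; exact: measurable_funTS. Qed.

Let mUE D k : measurable_fun D (fun t => (U k t)%:E).
Proof. by apply/measurable_EFinP; exact: measurable_funTS. Qed.

Let intV_ge0 A k : (0 <= \int[P]_(t in A) (V k t)%:E)%E.
Proof. by apply: integral_ge0 => t _; rewrite lee_fin. Qed.

Let intU_ge0 A k : (0 <= \int[P]_(t in A) (U k t)%:E)%E.
Proof. by apply: integral_ge0 => t _; rewrite lee_fin. Qed.

Let energy n : (\int[P]_t (V n t)%:E + \sum_(k < n) \int[P]_t (U k t)%:E <=
  \int[P]_t (V 0%N t)%:E + (\sum_(k < n) e k)%:E)%E.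
Proof.
elim: n => [|n ih]; first by rewrite !big_ord0 !adde0.
rewrite !big_ord_recr/= EFinD [X in (X <= _)%E](_ : _ =
  \int[P]_t (V n.+1 t)%:E + \int[P]_t (U n t)%:E +
  \sum_(k < n) \int[P]_t (U k t)%:E)%E; last by rewrite -addeA [X in (_ + X)%E]addeC.
have nT : <<s gen n >> setT := @measurableT _ (g_sigma_algebraType (gen n)).
apply: (le_trans (leeD2r _ (drift n setT nT))).
rewrite addeAC [leRHS]addeA; exact: leeD2r.
Qed.

Let K : \bar R := (\int[P]_t (V 0%N t)%:E + E%:E)%E.

Let Kfin : (K < +oo)%E.
Proof. by rewrite lte_add_pinfty// ltry. Qed.

Let energyK n : (\int[P]_t (V n t)%:E + \sum_(k < n) \int[P]_t (U k t)%:E <= K)%E.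
Proof. by apply: (le_trans (energy n)); rewrite leeD2l// lee_fin. Qed.

Let intV_leK n : (\int[P]_t (V n t)%:E <= K)%E.
Proof. by apply: le_trans (energyK n); rewrite leeDl// sume_ge0. Qed.

(** The telescoped drift bounds the integral of the whole series of [U] by [K], so that series is
    finite almost everywhere. *)
Lemma ae_bounded_sum_decrease :
  {ae P, forall t, exists C : R, forall n, \sum_(k < n) U k t <= C}.
Proof.
have mS : measurable_fun setT (fun t => \sum_(k <oo) (U k t)%:E)%E.
  apply: (@ge0_emeasurable_sum _ _ _ _ (fun k t => (U k t)%:E) xpredT) => //.
  by move=> k t _ _; rewrite lee_fin.
have S0 t : (0 <= \sum_(k <oo) (U k t)%:E)%E.
  by apply: nneseries_ge0 => k _ _; rewrite lee_fin.
have iS : P.-integrable setT (fun t => \sum_(k <oo) (U k t)%:E)%E.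
  apply/integrableP; split => //.
  under eq_integral do rewrite gee0_abs//.
  rewrite integral_nneseries//; last by move=> k t _; rewrite lee_fin.
  apply: le_lt_trans Kfin; apply: lime_le.
    by apply: is_cvg_nneseries => k _ _; exact: intU_ge0.
  apply: nearW => n; rewrite big_mkord; apply: le_trans (energyK n).
  by rewrite leeDr.
have := integrable_ae measurableT iS; apply: filterS => t /(_ I) /fineK St.
exists (fine (\sum_(k <oo) (U k t)%:E)%E) => n.
rewrite -lee_fin St -sumEFin -(big_mkord xpredT (fun k => (U k t)%:E)).
by apply: nneseries_lim_ge => k _ _; rewrite lee_fin.
Qed.

(** By Fatou the lower limit of [V] has integral at most [K], hence is finite almost everywhere; the
    path returns below this limit plus [1] infinitely often. *)
Lemma ae_recurrent_bound :
  {ae P, forall t, exists c : R, forall N, exists2 k, (N <= k)%N & V k t <= c}.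
Proof.
pose L t := limn_einf (fun k => (V k t)%:E).
have L0 t : (0 <= L t)%E.
  rewrite /L limn_einf_lim; apply: lime_ge; first exact: is_cvg_einfs.
  by apply: nearW => m; apply: le_ereal_inf_tmp => _ [k _ <-]; rewrite lee_fin.
have mL : measurable_fun setT L.
  apply: (@emeasurable_fun_cvg _ _ _ _ (fun m t => einfs (fun k => (V k t)%:E) m)).
    by move=> m; exact: measurable_fun_einfs.
  by move=> t _; rewrite /L limn_einf_lim; exact: is_cvg_einfs.
have iL : P.-integrable setT L.
  apply/integrableP; split => //.
  under eq_integral do rewrite gee0_abs//.
  apply: le_lt_trans Kfin.
  apply: (le_trans (fatou _ measurableT _ _)) => //.
    by move=> k t _; rewrite lee_fin.
  rewrite limn_einf_lim; apply: lime_le; first exact: is_cvg_einfs.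
  apply: nearW => m; apply: le_trans (intV_leK m).
  by apply: ereal_inf_lbound; exists m => /=.
have := integrable_ae measurableT iL; apply: filterS => t /(_ I) /fineK Lt.
exists (fine (L t) + 1) => N; apply: contrapT => hN.
have : ((fine (L t) + 1)%:E <= L t)%E.
  have LE : L t = ereal_sup (range (einfs (fun k => (V k t)%:E))).
    by rewrite /L limn_einf_lim; apply/cvg_lim => //; exact: cvg_einfs_sup.
  rewrite [leRHS]LE; apply: le_trans (ereal_sup_ubound _) => /=; last by exists N.
  apply: le_ereal_inf_tmp => _ [k /= Nk <-]; rewrite lee_fin leNgt; apply/negP => kc.
  by apply: hN; exists k => //; exact: ltW.
by rewrite -{2}Lt lee_fin gerDl leNgt ltr01.
Qed.

Let hold a b k : set T := [set t | holding (V ^~ t) a b k].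

(** Membership in the past at time [k] is what allows the drift inequality to be used over the
    holding event. *)
Let mhold a b k : <<s gen k >> (hold a b k).
Proof.
elim: k => [|k ih].
  rewrite /hold/=; have := @measurable_fun_le _ (g_sigma_algebraType (gen 0%N)) R setT
    (V 0%N) (cst a) measurableT (mV 0%N) (measurable_cst _).
  by rewrite setTI.
have mlt : <<s gen k.+1 >> [set t | V k.+1 t < b].
  have := @measurable_fun_ltr _ (g_sigma_algebraType (gen k.+1)) R setT
    (V k.+1) (cst b) (mV k.+1) (measurable_cst _) measurableT [set true] I.
  by rewrite setTI preimage_true.
have mle : <<s gen k.+1 >> [set t | V k.+1 t <= a].
  have := @measurable_fun_le _ (g_sigma_algebraType (gen k.+1)) R setT
    (V k.+1) (cst a) measurableT (mV k.+1) (measurable_cst _).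
  by rewrite setTI.
have mh : <<s gen k.+1 >> (hold a b k) by exact: gen_mono.
rewrite [hold _ _ _](_ : _ = (hold a b k `&` [set t | V k.+1 t < b]) `|`
  (~` hold a b k `&` [set t | V k.+1 t <= a])); last first.
  apply/seteqP; rewrite /hold; split => t /=; case: ifPn => //=.
  - by move=> h1 h2; left.
  - by move=> /negP h1 h2; right.
  - by move=> h1 [[]|[]].
  - by move=> /negP h1 [[]|[]].
apply: (@measurableU _ (g_sigma_algebraType (gen k.+1))).
  exact: (@measurableI _ (g_sigma_algebraType (gen k.+1))).
apply: (@measurableI _ (g_sigma_algebraType (gen k.+1))) => //.
exact: (@measurableC _ (g_sigma_algebraType (gen k.+1))).
Qed.

Let cross a b k : set T := [set t | crossing (V ^~ t) a b k].

Let mcross a b k : measurable (cross a b k).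
Proof.
rewrite [cross _ _ _](_ : _ = hold a b k `&` [set t | b <= V k.+1 t]).
  apply: measurableI; first exact: (gen_sub k _ (mhold a b k)).
  have := @measurable_fun_le _ T R setT (cst b) (V k.+1) measurableT
     (measurable_cst _) (mVT k.+1).
  by rewrite setTI.
by apply/seteqP; split => t /=; rewrite /cross/= /crossing => /andP.
Qed.

(** Integrating [holding_gain] bounds the crossings by the gains of the strategy plus [a]. The drift
    over each holding event bounds the expected gain at step [k] by [e k], which leaves [E + a] in
    total. *)
Let upcrossing_bound a b n : 0 <= a -> a < b ->
  (\sum_(k < n) P (cross a b k) <= ((E + a) / (b - a))%:E)%E.
Proof.
move=> a0 ab.
have mh k : measurable (hold a b k) by exact: (gen_sub k _ (mhold a b k)).
have intE (f : T -> R) k : (\int[P]_t ((holding (V ^~ t) a b k)%:R * f t)%:E =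
    \int[P]_(t in hold a b k) (f t)%:E)%E.
  rewrite [RHS]integral_mkcond; apply: eq_integral => t _.
  rewrite patchE; case: ifPn => [/set_mem|/negP tN].
    by rewrite /hold/= => ->; rewrite mul1r.
  by rewrite (_ : holding _ _ _ _ = false) ?mul0r//; apply/negP => ?; apply/tN/mem_set.
have intC k : (\int[P]_t (((crossing (V ^~ t) a b k)%:R : R)%:E) = P (cross a b k))%E.
  rewrite -(setIT (cross a b k)) -integral_indic//; apply: eq_integral => t _.
  rewrite indicE; congr (_%:R%:E); congr nat_of_bool; apply/idP/idP.
    by move=> ?; apply/mem_set.
  by move/set_mem.
have mhR k : measurable_fun setT (fun t => (holding (V ^~ t) a b k)%:R : R).
  rewrite (_ : (fun _ => _) = \1_(hold a b k)).
    by apply: measurable_indic.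
  apply/funext => t; rewrite indicE; congr (_%:R); congr nat_of_bool; apply/idP/idP.
    by move=> ?; apply/mem_set.
  by move/set_mem.
have mcR k : measurable_fun setT (fun t => (crossing (V ^~ t) a b k)%:R : R).
  rewrite (_ : (fun _ => _) = \1_(cross a b k)).
    by apply: measurable_indic.
  apply/funext => t; rewrite indicE; congr (_%:R); congr nat_of_bool; apply/idP/idP.
    by move=> ?; apply/mem_set.
  by move/set_mem.
have mhV k j : measurable_fun setT
    (fun t => ((holding (V ^~ t) a b k)%:R * V j t)%:E).
  by apply/measurable_EFinP; exact: measurable_funM.
(* [X] appears on both sides of the final inequality; its finiteness permits the cancellation. *)
pose X := (\sum_(k < n) \int[P]_(t in hold a b k) (V k t)%:E)%E.
have Xfin : X \is a fin_num.
  rewrite sum_fin_num; apply/allP => _ /mapP[k _ ->] /=; rewrite ge0_fin_numE//.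
  apply: le_lt_trans Kfin; apply: le_trans (intV_leK k).
  by apply: ge0_subset_integral => // t _; rewrite lee_fin.
have hV0 k j t : (0 <= ((holding (V ^~ t) a b k)%:R * V j t)%:E)%E.
  by rewrite lee_fin mulr_ge0.
have c0 k t : (0 <= ((crossing (V ^~ t) a b k)%:R : R)%:E)%E by rewrite lee_fin.
have mc k : measurable_fun setT (fun t => ((crossing (V ^~ t) a b k)%:R : R)%:E).
  exact/measurable_EFinP.
have ba0 : 0 <= b - a by rewrite subr_ge0 ltW.
have key : (X + (b - a)%:E * \sum_(k < n) P (cross a b k) <=
    \sum_(k < n) \int[P]_(t in hold a b k) (V k.+1 t)%:E + a%:E)%E.
  pose G t := (\sum_(k < n) ((holding (V ^~ t) a b k)%:R * V k t)%:E)%E.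
  pose C t := (\sum_(k < n) (((crossing (V ^~ t) a b k)%:R : R)%:E))%E.
  pose G' t := (\sum_(k < n) ((holding (V ^~ t) a b k)%:R * V k.+1 t)%:E)%E.
  have G0 t : setT t -> (0 <= G t)%E by move=> _; exact: sume_ge0.
  have C0 t : setT t -> (0 <= C t)%E by move=> _; exact: sume_ge0.
  have G'0 t : setT t -> (0 <= G' t)%E by move=> _; exact: sume_ge0.
  have mG : measurable_fun setT G by exact: emeasurable_sum.
  have mC : measurable_fun setT C by exact: emeasurable_sum.
  have mG' : measurable_fun setT G' by exact: emeasurable_sum.
  have mbC : measurable_fun setT (fun t => (b - a)%:E * C t)%E.
    exact: measurable_funeM.
  have bC0 t : setT t -> (0 <= (b - a)%:E * C t)%E.
    by move=> _; apply: mule_ge0; [rewrite lee_fin|exact: C0].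
  have : (\int[P]_t (G t + (b - a)%:E * C t) <= \int[P]_t (G' t + a%:E))%E.
    apply: ge0_le_integral => //.
    - by move=> t _; apply: adde_ge0; [exact: G0|exact: bC0].
    - exact: emeasurable_funD.
    - exact: emeasurable_funD.
    - move=> t _; rewrite /G /C /G' !sumEFin -EFinM -!EFinD lee_fin.
      have := holding_gain (V ^~ t) a b n a0 (ltW ab) (V0 ^~ t).
      have : 0 <= (holding (V ^~ t) a b n)%:R * V n t by rewrite mulr_ge0.
      have : (holding (V ^~ t) a b n)%:R * a <= a.
        by case: (holding _ _ _ _); rewrite ?mul1r// mul0r.
      lra.
  rewrite (ge0_integralD _ measurableT G0 mG bC0 mbC).
  rewrite (ge0_integralZl_EFin _ measurableT C0 mC ba0).
  rewrite (ge0_integralD _ measurableT G'0 mG')//.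
  rewrite integral_cst//= probability_setT mule1.
  rewrite /G /C /G' !ge0_integral_sum//.
  rewrite (eq_bigr _ (fun (k : 'I_n) _ => intE (V k) k)) (eq_bigr _ (fun (k : 'I_n) _ => intC k)).
  by rewrite (eq_bigr _ (fun (k : 'I_n) _ => intE (V k.+1) k)).
have : (X + (b - a)%:E * \sum_(k < n) P (cross a b k) <= X + (E + a)%:E)%E.
  apply: (le_trans key); rewrite EFinD addeA leeD2r//.
  apply: (@le_trans _ _ (X + (\sum_(k < n) e k)%:E)%E); last first.
    by rewrite leeD2l// lee_fin.
  rewrite -sumEFin /X -big_split/=; apply: lee_sum => k _.
  by apply: le_trans (drift k _ (mhold a b k)); rewrite leeDl.
rewrite leeD2lE// => h.
rewrite EFinM [leRHS]muleC lee_pdivlMl ?subr_gt0//.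
Qed.

(** First Borel-Cantelli lemma: the bound on the sums of crossing probabilities is uniform in
    [n]. *)
Lemma ae_finite_crossings a b : 0 <= a -> a < b ->
  {ae P, forall t, exists N, forall k, (N <= k)%N -> ~~ crossing (V ^~ t) a b k}.
Proof.
move=> a0 ab.
have h : P (lim_sup_set (cross a b)) = 0.
  apply: lim_sup_set_cvg0 => //.
  apply: (@le_lt_trans _ _ ((E + a) / (b - a))%:E); last exact: ltry.
  apply: lime_le; first by apply: is_cvg_nneseries => k _ _.
  by apply: nearW => n; rewrite big_mkord; exact: upcrossing_bound.
exists (lim_sup_set (cross a b)); split => //.
  apply: bigcapT_measurable => N; apply: bigcup_measurable => k _; exact: mcross.
move=> t /= ht N _; apply: contrapT => hN; apply: ht; exists N => k Nk.
by apply/negP => hk; apply: hN; exists k.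
Qed.

Theorem almost_supermartingale_cvg :
  {ae P, forall t, cvgn (V ^~ t) /\
     exists C : R, forall n, \sum_(k < n) U k t <= C}.
Proof.
have hcr : {ae P, forall t (qr : rat * rat), 0 <= (ratr qr.1 : R) ->
    (ratr qr.1 : R) < ratr qr.2 ->
    exists N, forall k, (N <= k)%N -> ~~ crossing (V ^~ t) (ratr qr.1) (ratr qr.2) k}.
  apply: ae_forall_countType => -[q r]/=.
  have [q0|q0] := leP 0 (ratr q : R); last by apply: aeW.
  have [qr|qr] := ltP (ratr q : R) (ratr r); last by apply: aeW => t _ /=.
  by apply: filterS (ae_finite_crossings _ _ q0 qr).
apply: filterS3 hcr ae_recurrent_bound ae_bounded_sum_decrease => t h1 h2 h3.
split => //; apply: cvgn_of_finite_crossings => // q r q0 qr.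
exact: (h1 (q, r)).
Qed.

End AlmostSupermartingale.

(** * Drift of the Lyapunov function over one step *)

Lemma affine_moment_le {R : realDomainType} (a b v c : R) :
  0 <= a -> 0 <= b -> 0 <= v -> 0 <= c ->
  a + b * (4 * (v + c)) <= (a + 4 * b * (1 + c)) * (v + 1).
Proof.
move=> a0 b0 v0 c0; rewrite -subr_ge0.
rewrite (_ : _ - _ = a * v + 4 * b + 4 * b * c * v); last by ring.
by rewrite !addr_ge0// !mulr_ge0.
Qed.

Section OneStepDrift.
Context {R : realType} {n : nat} (p : R) (H : 'rV[R]_n -> 'rV[R]_n).
Hypothesis p12 : 1 < p <= 2.
Hypothesis Hne : forall u v, enorm (H u - H v) <= enorm (u - v).
Context {d : measure_display} {Omega : measurableType d} (P : probability Omega R).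
Variable gen : set (set Omega).
Hypothesis gen_sub : <<s gen >> `<=` measurable.
Variables (X W : Omega -> 'rV[R]_n) (a A0 B : R) (y xbar : 'rV[R]_n).
Hypothesis mX : forall i, measurable_fun setT
  ((fun t => X t ord0 i) : g_sigma_algebraType gen -> R).
Hypothesis iW : forall i, P.-integrable setT (fun t => (W t ord0 i)%:E).
Hypothesis W0 : forall i S, <<s gen >> S -> (\int[P]_(t in S) (W t ord0 i)%:E = 0)%E.
Hypothesis W_moment : forall S, <<s gen >> S ->
  (\int[P]_(t in S) (enorm (W t) `^ p)%:E <=
   \int[P]_(t in S) (A0 + B * enorm (X t - xbar) `^ p)%:E)%E.
Hypothesis a01 : 0 < a <= 1.
Hypothesis A0_ge0 : 0 <= A0.
Hypothesis B_ge0 : 0 <= B.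
Hypothesis Hy : H y = y.

Let V t := enorm (X t - y) `^ p.
Let z t := X t + a *: (H (X t) - X t) - y.
Let U t := V t - enorm (z t) `^ p.
Let N t := enorm (W t) `^ p.
Let c0 := A0 + 4 * B * (1 + enorm (y - xbar) `^ p).

Let p1 : 1 < p. Proof. by case/andP: p12. Qed.
Let p0 : 0 < p. Proof. exact: lt_trans p1. Qed.
Let a0 : 0 < a. Proof. by case/andP: a01. Qed.

Let z_le t : enorm (z t) <= enorm (X t - y).
Proof.
rewrite -(@ler_pXn2r _ 2) ?nnegrE ?enorm_ge0//.
apply: (le_trans (averaged_sqr H Hne a (X t) y (ltW a0) Hy)).
rewrite gerBl; apply: mulr_ge0 (sqr_ge0 _); apply: mulr_ge0; first exact: ltW.
by rewrite subr_ge0; case/andP: a01.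
Qed.

Let c0_ge0 : 0 <= c0.
Proof. by rewrite addr_ge0// !mulr_ge0// addr_ge0// powR_ge0. Qed.

Let menorm d' (T : measurableType d') (Y : T -> 'rV[R]_n) :
  (forall i, measurable_fun setT (fun t => Y t ord0 i)) ->
  measurable_fun setT (fun t => enorm (Y t)).
Proof.
move=> mY; apply: (measurable_lipschitz_comp _ _ _ _ _ _ mY) => u v.
by rewrite lerBlDr; have := enormD (u - v) v; rewrite subrK.
Qed.

Let mpow d' (T : measurableType d') (Y : T -> 'rV[R]_n) q :
  (forall i, measurable_fun setT (fun t => Y t ord0 i)) ->
  measurable_fun setT (fun t => enorm (Y t) `^ q).
Proof. by move=> /menorm mY; exact: measurableT_comp (measurable_powR q) mY. Qed.

Let mHX i : measurable_fun setT
  ((fun t => H (X t) ord0 i) : g_sigma_algebraType gen -> R).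
Proof.
apply: (measurable_lipschitz_comp _ _ _ (g_sigma_algebraType gen) X (fun u => H u ord0 i) mX) => u v.
apply: le_trans (Hne u v); apply: le_trans (coord_le_enorm _ i).
by rewrite !mxE; exact: ler_norm.
Qed.

Let mz i : measurable_fun setT
  ((fun t => z t ord0 i) : g_sigma_algebraType gen -> R).
Proof.
rewrite /z; under eq_fun do rewrite !mxE.
apply: measurable_funB (measurable_cst _); apply: measurable_funD (mX i) _.
exact: measurable_funM (measurable_cst a) (measurable_funB (mHX i) (mX i)).
Qed.

Let mXT i : measurable_fun setT (fun t => X t ord0 i).
Proof. exact: (sub_measurable_fun _ gen_sub). Qed.

Let mzT i : measurable_fun setT (fun t => z t ord0 i).
Proof. exact: (sub_measurable_fun _ gen_sub). Qed.

Let mWT i : measurable_fun setT (fun t => W t ord0 i).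
Proof. by apply/measurable_EFinP; case/integrableP: (iW i). Qed.

Let mV : measurable_fun setT V.
Proof.
apply: mpow => i; under eq_fun do rewrite !mxE.
exact: measurable_funB.
Qed.

Let mN : measurable_fun setT N. Proof. exact: mpow. Qed.

Let mU : measurable_fun setT U.
Proof. exact: measurable_funB mV (mpow _ _ _ _ mzT). Qed.

Let mV' : measurable_fun setT (fun t => enorm (z t + a *: W t) `^ p).
Proof.
apply: mpow => i; rewrite (_ : (fun _ => _) =
  (fun t => z t ord0 i + a * W t ord0 i)); last first.
  by apply/funext => t; rewrite mxE [X in _ + X]mxE.
exact: measurable_funD (mzT i) (measurable_funM (measurable_cst a) (mWT i)).
Qed.

Let U0 t : 0 <= U t.
Proof. by rewrite subr_ge0; exact: ler_powR_base (ltW p0) (enorm_ge0 _) (z_le t). Qed.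

(* The gradient of |.|^p at z t, times the step size. *)
Let f i t := p * a * enorm (z t) `^ (p - 2) * z t ord0 i.

Let mf i : measurable_fun setT (f i : g_sigma_algebraType gen -> R).
Proof.
apply: measurable_funM (mz i); apply: measurable_funM (measurable_cst _) _.
exact: (mpow _ (g_sigma_algebraType gen) _ _ mz).
Qed.

(** Makes the cross term integrable: the gradient has size [|z|^(p-1)], and Young's inequality
    splits its product with the noise into [p]-th powers. The factor [4] covers [p * a <= 2]. *)
Let f_le i t : `|f i t * W t ord0 i| <= 4 * (V t + N t).
Proof.
have [p1' p2] := andP p12; have /andP[_ a1] := a01.
have zi : enorm (z t) `^ (p - 2) * `|z t ord0 i| <= enorm (z t) `^ (p - 1).
  (* At [z t = 0] the exponents cannot be added, but the coordinate itself vanishes. *)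
  have [z0|z0] := eqVneq (enorm (z t)) 0.
    have /eqP -> : `|z t ord0 i| == 0.
      by rewrite eq_le normr_ge0 andbT -z0 coord_le_enorm.
    by rewrite mulr0 powR_ge0.
  have -> : p - 1 = (p - 2) + 1 by lra.
  rewrite (@powRD _ _ (p - 2) 1) ?z0 ?implybT// powRr1 ?enorm_ge0//.
  by rewrite ler_wpM2l ?powR_ge0 ?coord_le_enorm.
rewrite !normrM (ger0_norm (ltW p0)) (ger0_norm (ltW a0)) ger0_norm ?powR_ge0//.
have h1 : enorm (z t) `^ (p - 1) * enorm (W t) <= V t + N t.
  apply: (le_trans (powR_young _ _ _ p1 (enorm_ge0 _) (enorm_ge0 _))).
  by rewrite lerD2r; exact: ler_powR_base (ltW p0) (enorm_ge0 _) (z_le t).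
have h2 : enorm (z t) `^ (p - 2) * `|z t ord0 i| * `|W t ord0 i| <= V t + N t.
  by apply: le_trans h1; apply: ler_pM => //; rewrite ?mulr_ge0 ?powR_ge0 ?coord_le_enorm.
have pa : p * a <= 4.
  by apply: (@le_trans _ _ (2 * 1)); [apply: ler_pM => //; exact: ltW|lra].
rewrite -(mulrA (p * a)) -(mulrA (p * a)); apply: ler_pM => //.
- by rewrite mulr_ge0// ltW.
- by rewrite !mulr_ge0// powR_ge0.
Qed.

Let pointwise t : enorm (z t + a *: W t) `^ p + U t <=
  V t + \sum_(i < n) f i t * W t ord0 i + 6 * a `^ p * N t.
Proof.
have := enorm_powR_expand p (z t) (a *: W t) p12.
rewrite enormZ (gtr0_norm a0) powRM ?enorm_ge0 ?(ltW a0)//.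
rewrite edotC edotZl edotC.
have -> : \sum_(i < n) f i t * W t ord0 i =
    p * enorm (z t) `^ (p - 2) * (a * edot (z t) (W t)).
  by rewrite /edot !mulr_sumr; apply: eq_bigr => i _; rewrite /f; ring.
have shift (q s r m : R) : q <= s + r + m -> q + (V t - s) <= V t + r + m by lra.
by rewrite (mulrA 6) => /shift.
Qed.

Variable S : set Omega.
Hypothesis FS : <<s gen >> S.
Let mS : measurable S := gen_sub _ FS.

(** The triangle inequality moves the centre of the noise bound from [xbar] to [y], whence the
    constant [c0]; the [1] bounds the probability of [S]. *)
Let V_moment : (\int[P]_(t in S) (N t)%:E <=
  c0%:E * (\int[P]_(t in S) (V t)%:E + 1))%E.
Proof.
apply: (le_trans (W_moment S FS)).
have mE (g : Omega -> R) : measurable_fun setT g ->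
  measurable_fun S (fun t => (g t)%:E).
  by move=> mg; apply/measurable_EFinP; exact: measurable_funTS.
have mxb : measurable_fun setT (fun t => A0 + B * enorm (X t - xbar) `^ p).
  apply: measurable_funD (measurable_cst _) _.
  apply: measurable_funM (measurable_cst _) _.
  apply: mpow => i; under eq_fun do rewrite !mxE.
  exact: measurable_funB.
apply: (@le_trans _ _ (\int[P]_(t in S) (c0%:E * ((V t)%:E + 1)))%E).
  apply: ge0_le_integral => //.
  - by move=> t _; rewrite lee_fin addr_ge0// mulr_ge0// powR_ge0.
  - exact: mE.
  - apply: measurable_funeM; apply: emeasurable_funD => //; exact: mE.
  - move=> t _; rewrite -EFinD -EFinM lee_fin.
    have h1 : enorm (X t - xbar) `^ p <= 4 * (V t + enorm (y - xbar) `^ p).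
      apply: le_trans (powRD_le4 _ _ _ p12 (enorm_ge0 _) (enorm_ge0 _)).
      by rewrite ler_powR_base ?enorm_ge0 ?(ltW p0) ?enormB_triangle.
    have := affine_moment_le _ _ _ _ A0_ge0 B_ge0 (powR_ge0 (enorm (X t - y)) p)
      (powR_ge0 (enorm (y - xbar)) p).
    apply: le_trans.
    by rewrite lerD2l ler_wpM2l.
rewrite ge0_integralZl_EFin//; last 2 first.
- by move=> t _; rewrite -EFinD lee_fin addr_ge0// powR_ge0.
- by apply: emeasurable_funD => //; exact: mE.
rewrite lee_wpmul2l ?lee_fin// ge0_integralD//; last 2 first.
- by move=> t _; rewrite lee_fin powR_ge0.
- exact: mE.
by rewrite leeD2l// integral_cst// mul1e probability_le1.
Qed.

Let drift :
  (\int[P]_(t in S) (enorm (z t + a *: W t) `^ p)%:E + \int[P]_(t in S) (U t)%:E <=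
   \int[P]_(t in S) (V t)%:E +
   (6 * c0 * a `^ p)%:E * (\int[P]_(t in S) (V t)%:E + 1))%E.
Proof.
have V0 t : 0 <= V t by exact: powR_ge0.
have IV0 : (0 <= \int[P]_(t in S) (V t)%:E)%E.
  by apply: integral_ge0 => t _; rewrite lee_fin.
(* With an infinite integral the right side is [+oo]. Otherwise [V], then [N], then the cross term
   are integrable over [S]. *)
have [Voo|Vfin] := eqVneq (\int[P]_(t in S) (V t)%:E)%E +oo%E.
  have c60 : (0 <= (6 * c0 * a `^ p)%:E)%E.
    by rewrite lee_fin; apply: mulr_ge0 (powR_ge0 _ _); exact: mulr_ge0.
  have := mule_ge0 c60 (adde_ge0 IV0 (@lee01 R)).
  move=> h; rewrite [X in (_ <= X + _)%E]Voo addye ?leey//.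
  by rewrite gt_eqF// (lt_le_trans (ltNyr 0)).
have mE (g : Omega -> R) : measurable_fun setT g ->
  measurable_fun S (fun t => (g t)%:E).
  by move=> mg; apply/measurable_EFinP; exact: measurable_funTS.
have iV : P.-integrable S (fun t => (V t)%:E).
  apply/integrableP; split; first exact: mE.
  rewrite (eq_integral (fun t => (V t)%:E)).
    by rewrite ltey; exact: Vfin.
  by move=> t _; rewrite gee0_abs// lee_fin.
have iN : P.-integrable S (fun t => (N t)%:E).
  apply/integrableP; split; first exact: mE.
  rewrite (eq_integral (fun t => (N t)%:E)); last first.
    by move=> t _; rewrite gee0_abs// lee_fin powR_ge0.
  apply: (le_lt_trans V_moment); rewrite lte_mul_pinfty ?lee_fin//.
  by rewrite lte_add_pinfty// ?ltey// ltry.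
have mfW i : measurable_fun setT (fun t => f i t * W t ord0 i).
  by apply: measurable_funM => //; exact: (sub_measurable_fun _ gen_sub _ _ _ (mf i)).
have ifW i : P.-integrable S (fun t => (f i t * W t ord0 i)%:E).
  apply: (@le_integrable _ _ _ P S mS _ (fun t => (4%:E * ((V t)%:E + (N t)%:E))%E)).
  - exact: mE.
  - move=> t _; rewrite -EFinD -EFinM /= lee_fin [leRHS]ger0_norm ?f_le//.
    by rewrite mulr_ge0// addr_ge0// powR_ge0.
  - by apply: integrableZl => //; exact: integrableD.
have fW0 i : (\int[P]_(t in S) (f i t * W t ord0 i)%:E = 0)%E.
  (* The indicator of the past event [S] is absorbed into the multiplier, so that orthogonality
     applies on the whole space. *)
  have patchE' : (fun t => (f i t * \1_S t * W t ord0 i)%:E) =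
      (fun t => (f i t * W t ord0 i)%:E) \_ S.
    apply/funext => t; rewrite patchE indicE; case: ifPn => tA /=.
      by rewrite mulr1.
    by rewrite mulr0 mul0r.
  rewrite integral_mkcond -patchE'.
  apply: (integral_orthogonal _ gen_sub P _ (iW i) (W0 i) (fun t => f i t * \1_S t)).
    apply: measurable_funM (mf i) _.
    exact: (@measurable_indic _ (g_sigma_algebraType gen) R setT S FS).
  by rewrite patchE' -integrable_mkcond.
have V'0 t : S t -> (0 <= (enorm (z t + a *: W t) `^ p)%:E)%E.
  by move=> _; rewrite lee_fin powR_ge0.
have U0' t : S t -> (0 <= (U t)%:E)%E by move=> _; rewrite lee_fin.
have e1 := ge0_integralD P mS V'0 (mE _ mV') U0' (mE _ mU).
suff h : (\int[P]_(t in S) ((enorm (z t + a *: W t) `^ p)%:E + (U t)%:E) <=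
    \int[P]_(t in S) (V t)%:E +
    (6 * c0 * a `^ p)%:E * (\int[P]_(t in S) (V t)%:E + 1))%E.
  exact: (eq_ind _ (fun v => (v <= _)%E) h _ e1).
pose M t := (\sum_(i < n) (f i t * W t ord0 i)%:E)%E.
have iM : P.-integrable S M by apply: integrable_sum.
apply: (@le_trans _ _ (\int[P]_(t in S)
   ((V t)%:E + M t + (6 * a `^ p)%:E * (N t)%:E))%E).
  apply: ge0_le_integral => //.
  - by move=> t _; rewrite -EFinD lee_fin addr_ge0// powR_ge0.
  - by apply: emeasurable_funD; exact: mE.
  - apply: emeasurable_funD; last by apply: measurable_funeM; exact: mE.
    by apply: emeasurable_funD; [exact: mE|case/integrableP: iM].
  - move=> t _; rewrite /M sumEFin -EFinM -!EFinD lee_fin; exact: pointwise.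
rewrite integralD//; last 2 first.
- exact: integrableD.
- exact: integrableZl.
rewrite integralD// /M integral_sum// big1// adde0 leeD2l//.
have -> : 6 * c0 * a `^ p = 6 * a `^ p * c0 by rewrite mulrAC.
rewrite integralZl// [X in (_ <= X * _)%E]EFinM -[leRHS]muleA lee_wpmul2l//.
by rewrite lee_fin mulr_ge0// powR_ge0.
Qed.

Lemma one_step_drift :
  (\int[P]_(t in S) (enorm (X t + a *: (H (X t) - X t + W t) - y) `^ p)%:E +
   \int[P]_(t in S)
     (enorm (X t - y) `^ p - enorm (X t + a *: (H (X t) - X t) - y) `^ p)%:E <=
   \int[P]_(t in S) (enorm (X t - y) `^ p)%:E +
   (6 * (A0 + 4 * B * (1 + enorm (y - xbar) `^ p)) * a `^ p)%:E *
     (\int[P]_(t in S) (enorm (X t - y) `^ p)%:E + 1))%E.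
Proof.
have zE t : X t + a *: (H (X t) - X t + W t) - y = z t + a *: W t.
  by rewrite /z scalerDr (addrA (X t)) [LHS]addrAC.
have e1 : (\int[P]_(t in S) (enorm (z t + a *: W t) `^ p)%:E =
    \int[P]_(t in S) (enorm (X t + a *: (H (X t) - X t + W t) - y) `^ p)%:E)%E.
  by apply: eq_integral => t _; rewrite zE.
exact: (eq_ind _ (fun v => (v + _ <= _)%E) drift _ e1).
Qed.

End OneStepDrift.

(** * The stochastic iteration seen from one fixed point: localisation and summable errors *)

Lemma integral_mul_indic {d : measure_display} {T : measurableType d} {R : realType}
    (mu : {measure set T -> \bar R}) (A S : set T) (f : T -> R) :
  (\int[mu]_(t in A) (f t * \1_S t)%:E = \int[mu]_(t in A `&` S) (f t)%:E)%E.
Proof.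
rewrite integral_mkcondr; apply: eq_integral => t _; rewrite patchE indicE.
by case: ifPn => _ /=; rewrite ?mulr1 ?mulr0.
Qed.

Lemma powR_summable_cvg0 (R : realType) (p : R) (alpha : nat -> R) :
  0 < p -> (forall k, 0 < alpha k) -> cvgn (series (fun k => alpha k `^ p)) ->
  alpha @ \oo --> 0.
Proof.
move=> p0 a0 /cvg_series_cvg_0/cvgrPdist_lt h.
apply/cvgrPdist_lt => e e0; have := h _ (powR_gt0 p e0).
apply: filterS => k; rewrite !sub0r !normrN ger0_norm ?powR_ge0// => hk.
rewrite gtr0_norm// ltNge; apply/negP => ea; move: hk; apply/negP.
by rewrite -leNgt; exact: ler_powR_base (ltW p0) (ltW e0) ea.
Qed.

Section KrasnoselskiiMann.
Context {R : realType} {n : nat} (p : R) (H : 'rV[R]_n -> 'rV[R]_n).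
Context {d : measure_display} {Omega : measurableType d} (P : probability Omega R).
Variables (x w : nat -> Omega -> 'rV[R]_n) (alpha : nat -> R).
Variables (xbar : 'rV[R]_n) (A B : R).
Hypothesis p12 : 1 < p <= 2.
Hypothesis Hne : forall u v, enorm (H u - H v) <= enorm (u - v).
Hypothesis mx0 : forall i : 'I_n, measurable_fun setT (fun om => x 0%N om ord0 i).
Hypothesis xS : forall k om,
  x k.+1 om = x k om + alpha k *: (H (x k om) - x k om + w k om).
Hypothesis iw : forall k (i : 'I_n), P.-integrable setT (fun om => (w k om ord0 i)%:E).
Hypothesis w_centered : forall k (i : 'I_n), exists Y : Omega -> R,
  is_cond_exp P (natural_filtration x k) (fun om => w k om ord0 i) Y /\
  {ae P, forall om, Y om = 0}.
Hypothesis A0 : 0 <= A.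
Hypothesis B0 : 0 <= B.
Hypothesis w_moment : forall k, exists Y : Omega -> \bar R,
  is_cond_exp_nneg P (natural_filtration x k) (fun om => enorm (w k om) `^ p) Y /\
  {ae P, forall om, (Y om <= (A + B * enorm (x k om - xbar) `^ p)%:E)%E}.
Hypothesis alpha0 : forall k, 0 < alpha k.
Hypothesis alphap_sum : cvgn (series (fun k => alpha k `^ p)).

Let p0 : 0 < p.
Proof. by case/andP: p12 => + _; apply: lt_trans. Qed.

(** The generating family of [natural_filtration x k], named so that it can index
    [g_sigma_algebraType]. *)
Let gen k : set (set Omega) :=
  [set S | exists j : nat, exists i : 'I_n, exists C : set R,
     (j <= k)%N /\ measurable C /\ S = (fun om => x j om ord0 i) @^-1` C].

Let gen_mono k : <<s gen k >> `<=` <<s gen k.+1 >>.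
Proof.
apply: smallest_sub; first exact: smallest_sigma_algebra.
move=> S [j [i [C [jk [mC ->]]]]]; apply: sub_sigma_algebra.
by exists j, i, C; split => //; exact: leqW.
Qed.

Let mx k i : measurable_fun setT (fun om => x k om ord0 i).
Proof.
elim: k i => [|k ih] i; first exact: mx0.
under eq_fun do rewrite xS !mxE.
apply: measurable_funD => //; apply: measurable_funM => //.
apply: measurable_funD; last by apply/measurable_EFinP; case/integrableP: (iw k i).
apply: measurable_funB => //.
apply: (measurable_lipschitz_comp _ _ _ _ (x k) (fun u => H u ord0 i) ih) => u v.
apply: le_trans (Hne u v); apply: le_trans (coord_le_enorm _ i).
by rewrite !mxE; exact: ler_norm.
Qed.

Let gen_sub k : <<s gen k >> `<=` measurable.
Proof.
apply: smallest_sub; first exact: sigma_algebra_measurable.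
by move=> S [j [i [C [jk [mC ->]]]]]; rewrite -[X in measurable X]setTI; exact: mx.
Qed.

Let mxgen k i : measurable_fun setT
  ((fun om => x k om ord0 i) : g_sigma_algebraType (gen k) -> R).
Proof.
move=> _ C mC; rewrite setTI; apply: sub_sigma_algebra.
by exists k, i, C.
Qed.

Let w_orthogonal k i S : <<s gen k >> S -> (\int[P]_(om in S) (w k om ord0 i)%:E = 0)%E.
Proof.
move=> FS; have [Y [[_ [_ [iY ->//]]] Y0]] := w_centered k i.
have mS := gen_sub _ _ FS.
rewrite (ae_eq_integral (cst 0%E)) ?integral0//.
  by apply: measurable_funTS; case/integrableP: iY.
by apply: filterS Y0 => om /= -> _.
Qed.

Let w_moment_int k S : <<s gen k >> S ->
  (\int[P]_(om in S) (enorm (w k om) `^ p)%:E <=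
   \int[P]_(om in S) (A + B * enorm (x k om - xbar) `^ p)%:E)%E.
Proof.
move=> FS; have [Y [[mY [Y0 YE]] Yle]] := w_moment k.
rewrite (YE S FS); have mS := gen_sub _ _ FS.
have mYT : measurable_fun setT Y.
  by move=> _ C mC; rewrite setTI; apply: gen_sub; exact: mY.
have mD : measurable_fun setT (fun om => enorm (x k om - xbar)).
  apply: (measurable_lipschitz_comp _ _ _ _ (x k) (fun u => enorm (u - xbar))) => // u v.
  by rewrite lerBlDr enormB_triangle.
apply: ae_ge0_le_integral => //.
- exact: measurable_funTS.
- by move=> om _; rewrite lee_fin addr_ge0// mulr_ge0// powR_ge0.
- apply/measurable_EFinP; apply: measurable_funTS.
  apply: measurable_funD (measurable_cst _) _.
  apply: measurable_funM (measurable_cst _) _.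
  exact: measurableT_comp (measurable_powR p) mD.
- by apply: filterS Yle => om.
Qed.

Let genD k j : <<s gen k >> `<=` <<s gen (k + j) >>.
Proof.
by elim: j => [|j ih]; rewrite ?addn0// addnS => S /ih; exact: gen_mono.
Qed.

Let V (y : 'rV[R]_n) k om := enorm (x k om - y) `^ p.
Let U (y : 'rV[R]_n) k om :=
  V y k om - enorm (x k om + alpha k *: (H (x k om) - x k om) - y) `^ p.

(* The step sizes may exceed 1 at first, so the argument starts at index k0. *)
Variable k0 : nat.
Hypothesis alpha1 : forall j, alpha (k0 + j)%N <= 1.

Section FixedPoint.
Variables (y : 'rV[R]_n) (M : nat).
Hypothesis Hy : H y = y.

(* x k0 need not be integrable: localising on this event makes the Lyapunov
   function integrable from time k0 on. *)
Let S : set Omega := [set om | enorm (x k0 om - y) <= M%:R].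

Let mDgen k : measurable_fun setT
  ((fun om => enorm (x k om - y)) : g_sigma_algebraType (gen k) -> R).
Proof.
apply: (measurable_lipschitz_comp _ _ _ (g_sigma_algebraType (gen k)) (x k)
  (fun u => enorm (u - y)) (mxgen k)) => u v.
by rewrite lerBlDr enormB_triangle.
Qed.

Let mVgen k : measurable_fun setT (V y k : g_sigma_algebraType (gen k) -> R).
Proof. exact: measurableT_comp (measurable_powR p) (mDgen k). Qed.

Let FS : <<s gen k0 >> S.
Proof.
have := @measurable_fun_le _ (g_sigma_algebraType (gen k0)) R setT
  (fun om => enorm (x k0 om - y)) (cst M%:R) measurableT (mDgen k0) (measurable_cst _).
by rewrite setTI.
Qed.

Let FSD j : <<s gen (k0 + j) >> S.
Proof. exact: genD. Qed.

Let mV k : measurable_fun setT (V y k).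
Proof. exact: (sub_measurable_fun _ (gen_sub k) _ _ _ (mVgen k)). Qed.

Let mHx k : measurable_fun setT
  (fun om => enorm (x k om + alpha k *: (H (x k om) - x k om) - y)).
Proof.
have mh i : measurable_fun setT (fun om => H (x k om) ord0 i).
  apply: (measurable_lipschitz_comp _ _ _ _ (x k) (fun u => H u ord0 i) (mx k)) => u v.
  apply: le_trans (Hne u v); apply: le_trans (coord_le_enorm _ i).
  by rewrite !mxE; exact: ler_norm.
apply: (measurable_lipschitz_comp _ _ _ _
  (fun om => x k om + alpha k *: (H (x k om) - x k om)) (fun u => enorm (u - y))) => [i|u v].
  under eq_fun do rewrite !mxE.
  apply: measurable_funD (mx k i) _.
  exact: measurable_funM (measurable_cst _) (measurable_funB (mh i) (mx k i)).
by rewrite lerBlDr enormB_triangle.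
Qed.

Let mU k : measurable_fun setT (U y k).
Proof. exact: measurable_funB (mV k) (measurableT_comp (measurable_powR p) (mHx k)). Qed.

Let V0 k om : 0 <= V y k om. Proof. exact: powR_ge0. Qed.

Let U0 j om : 0 <= U y (k0 + j) om.
Proof.
rewrite subr_ge0; apply: ler_powR_base (ltW p0) (enorm_ge0 _) _.
rewrite -(@ler_pXn2r _ 2) ?nnegrE ?enorm_ge0//.
apply: (le_trans (averaged_sqr H Hne _ _ y (ltW (alpha0 _)) Hy)).
rewrite gerBl; apply: mulr_ge0 (sqr_ge0 _); apply: mulr_ge0; first exact: ltW.
by rewrite subr_ge0.
Qed.

Let c := 6 * (A + 4 * B * (1 + enorm (y - xbar) `^ p)).
Let g j := alpha (k0 + j) `^ p.

Let c0 : 0 <= c.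
Proof.
rewrite /c; apply: mulr_ge0 => //; apply: addr_ge0 => //; apply: mulr_ge0.
  exact: mulr_ge0.
by rewrite addr_ge0// powR_ge0.
Qed.

Let cg0 j : 0 <= c * g j. Proof. by rewrite mulr_ge0// powR_ge0. Qed.

Let drift0 j T : <<s gen (k0 + j) >> T ->
  (\int[P]_(om in T) (V y (k0 + j.+1) om)%:E + \int[P]_(om in T) (U y (k0 + j) om)%:E <=
   \int[P]_(om in T) (V y (k0 + j) om)%:E +
   (c * g j)%:E * (\int[P]_(om in T) (V y (k0 + j) om)%:E + 1))%E.
Proof.
move=> FT; have a01 : 0 < alpha (k0 + j)%N <= 1 by rewrite alpha0 alpha1.
have h := one_step_drift p H p12 Hne P (gen (k0 + j)) (gen_sub _) (x (k0 + j)%N)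
  (w (k0 + j)%N) (alpha (k0 + j)%N) A B y xbar (mxgen _) (iw _) (w_orthogonal _)
  (w_moment_int _) a01 A0 B0 Hy T FT.
have e1 : (\int[P]_(om in T) (V y (k0 + j.+1) om)%:E = \int[P]_(om in T)
   (enorm (x (k0 + j)%N om + alpha (k0 + j)%N *:
     (H (x (k0 + j)%N om) - x (k0 + j)%N om + w (k0 + j)%N om) - y) `^ p)%:E)%E.
  by apply: eq_integral => om _; rewrite /V addnS xS.
exact: (eq_ind _ (fun v => (v + _ <= _)%E) h _ (esym e1)).
Qed.

Let intU_ge0 T j : (0 <= \int[P]_(om in T) (U y (k0 + j) om)%:E)%E.
Proof. by apply: integral_ge0 => om _; rewrite lee_fin. Qed.

Let intV_ge0 T k : (0 <= \int[P]_(om in T) (V y k om)%:E)%E.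
Proof. by apply: integral_ge0 => om _; rewrite lee_fin. Qed.

Let mS : measurable S. Proof. exact: (gen_sub _ _ FS). Qed.

(** Discrete Gronwall: a bound [r] on the integral becomes [r'] with
    [r' + 1 = (1 + c * g j) * (r + 1)], and [1 + u <= expR u]. The shift by [1] absorbs the constant
    part of the error; at time [k0] the localisation gives the bound [M^p]. *)
Let energy j : (\int[P]_(om in S) (V y (k0 + j) om)%:E <=
  ((M%:R `^ p + 1) * expR (c * \sum_(i < j) g i) - 1)%:E)%E.
Proof.
elim: j => [|j ih].
  rewrite big_ord0 mulr0 expR0 mulr1 addrK addn0.
  apply: (@le_trans _ _ (\int[P]_(om in S) (M%:R `^ p)%:E)%E).
    apply: ge0_le_integral => //.
    - by move=> om _; rewrite lee_fin.
    - by apply/measurable_EFinP; exact: measurable_funTS.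
    - move=> om Som; rewrite lee_fin; exact: ler_powR_base (ltW p0) (enorm_ge0 _) Som.
  by rewrite integral_cst// -[leRHS]mule1 lee_wpmul2l ?lee_fin ?powR_ge0 ?probability_le1.
set r := (_ - 1) in ih.
apply: (@le_trans _ _ (r + c * g j * (r + 1))%:E).
  apply: (@le_trans _ _ (\int[P]_(om in S) (V y (k0 + j) om)%:E +
    (c * g j)%:E * (\int[P]_(om in S) (V y (k0 + j) om)%:E + 1))%E).
    by apply: le_trans (drift0 j S (FSD j)); rewrite leeDl.
  rewrite [leRHS]EFinD; apply: leeD; first exact: ih.
  rewrite [leRHS]EFinM; apply: lee_wpmul2l; first by rewrite lee_fin.
  by rewrite [leRHS]EFinD leeD2r.
rewrite lee_fin big_ord_recr/= (mulrDr c) expRD (mulrA (_ + 1)).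
have r1 : 0 <= r + 1 by rewrite /r subrK mulr_ge0 ?expR_ge0// addr_ge0// powR_ge0.
have -> : (M%:R `^ p + 1) * expR (c * \sum_(i < j) g i) = r + 1 by rewrite /r subrK.
have := ler_wpM2l r1 (expR_ge1Dx (c * g j)).
by rewrite mulrDr mulr1 lerBrDr (mulrC (c * g j)) addrAC.
Qed.

Let Gsum : exists G : R, forall j, \sum_(i < j) g i <= G.
Proof.
exists (limn (series (fun k => alpha k `^ p))) => j.
have nd : nondecreasing_seq (series (fun k => alpha k `^ p)).
  by apply: nondecreasing_series => k _ _; exact: powR_ge0.
apply: le_trans (nondecreasing_cvgn_le nd alphap_sum (k0 + j)).
rewrite /series/= (big_cat_nat (n := k0)) ?leq_addr//=.
rewrite -{2}[k0]add0n big_addn addKn -(big_mkord xpredT g) [X in _ <= _ + X](_ : _ = \sum_(0 <= i < j) g i).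
  by rewrite lerDr sumr_ge0// => i _; exact: powR_ge0.
by apply: eq_bigr => i _; rewrite /g addnC.
Qed.

(** Multiplying [V] and [U] by the indicator of [S], an event of the past at every later time, keeps
    the drift. The uniform bound [K - 1] on the integrals over [S] replaces the factor
    [integral + 1] by [K], so the errors [c * g j * K] are deterministic and summable. *)
Lemma local_fejer_cvg : {ae P, forall om, enorm (x k0 om - y) <= M%:R ->
  cvgn (fun j => enorm (x (k0 + j)%N om - y) `^ p) /\
  exists C : R, forall m, \sum_(j < m) (enorm (x (k0 + j)%N om - y) `^ p -
    enorm (x (k0 + j)%N om + alpha (k0 + j)%N *:
      (H (x (k0 + j)%N om) - x (k0 + j)%N om) - y) `^ p) <= C}.
Proof.
have [G hG] := Gsum.
pose K := (M%:R `^ p + 1) * expR (c * G).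
have K0 : 0 <= K by rewrite mulr_ge0 ?expR_ge0// addr_ge0// powR_ge0.
have hK j : (\int[P]_(om in S) (V y (k0 + j) om)%:E <= (K - 1)%:E)%E.
  apply: (le_trans (energy j)); rewrite lee_fin lerD2r.
  by rewrite ler_wpM2l ?addr_ge0 ?powR_ge0// ler_expR ler_wpM2l.
pose Vl j om := V y (k0 + j) om * \1_S om.
pose Ul j om := U y (k0 + j) om * \1_S om.
have eE m : \sum_(j < m) c * g j * K <= c * G * K.
  by rewrite -mulr_suml -mulr_sumr ler_wpM2r// ler_wpM2l.
have gm j : <<s gen (k0 + j) >> `<=` <<s gen (k0 + j.+1) >> by rewrite addnS.
have Vl0 j om : 0 <= Vl j om by rewrite mulr_ge0.
have Ul0 j om : 0 <= Ul j om by rewrite mulr_ge0.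
have mVl j : measurable_fun setT (Vl j : g_sigma_algebraType (gen (k0 + j)) -> R).
  apply: measurable_funM (mVgen _) _.
  exact: (@measurable_indic _ (g_sigma_algebraType (gen (k0 + j))) R setT S (FSD j)).
have mUl j : measurable_fun setT (Ul j).
  by apply: measurable_funM (mU _) _; exact: measurable_indic.
have Vfin : (\int[P]_om (Vl 0%N om)%:E < +oo)%E.
  by rewrite integral_mul_indic setTI (le_lt_trans (hK 0%N))// ltry.
have dr j T : <<s gen (k0 + j) >> T ->
  (\int[P]_(om in T) (Vl j.+1 om)%:E + \int[P]_(om in T) (Ul j om)%:E <=
   \int[P]_(om in T) (Vl j om)%:E + (c * g j * K)%:E)%E.
  move=> FT; have transport (a b r a' b' r' e : \bar R) : a = a' -> b = b' -> r = r' ->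
    (a' + b' <= r' + e -> a + b <= r + e)%E by move=> -> -> ->.
  apply: (transport _ _ _ _ _ _ _ (integral_mul_indic P T S (V y (k0 + j.+1)))
    (integral_mul_indic P T S (U y (k0 + j))) (integral_mul_indic P T S (V y (k0 + j)))).
  have FTS : <<s gen (k0 + j) >> (T `&` S).
    exact: (@measurableI _ (g_sigma_algebraType (gen (k0 + j))) T S FT (FSD j)).
  apply: (le_trans (drift0 j _ FTS)); rewrite leeD2l// [leRHS]EFinM.
  apply: lee_wpmul2l; first by rewrite lee_fin.
  rewrite -[K](subrK 1) EFinD leeD2r//; apply: le_trans (hK j).
  apply: ge0_subset_integral => //.
  - by apply: measurableI => //; exact: (gen_sub _ _ FT).
  - by apply/measurable_EFinP; exact: measurable_funTS.
  - by move=> om _; rewrite lee_fin.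
have := almost_supermartingale_cvg P (fun j => gen (k0 + j)) gm (fun j => gen_sub _)
  Vl Ul (fun j => c * g j * K) (c * G * K) Vl0 Ul0 mVl mUl Vfin eE dr.
apply: filterS => om [h1 [C hC]] Som.
have S1 : \1_S om = 1 :> R by rewrite indicE mem_set.
split.
  by move: h1; rewrite /Vl S1; under eq_fun do rewrite mulr1.
exists C => m; apply: le_trans (hC m).
by apply: ler_sum => j _; rewrite /Ul S1 mulr1.
Qed.

End FixedPoint.

(** The localising events with integer radius [M] exhaust the space, at the cost of countably many
    null sets. *)
Lemma fejer_cvg y : H y = y -> {ae P, forall om,
  cvgn (fun j => enorm (x (k0 + j)%N om - y) `^ p) /\
  exists C : R, forall m, \sum_(j < m) (enorm (x (k0 + j)%N om - y) `^ p -
    enorm (x (k0 + j)%N om + alpha (k0 + j)%N *: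
      (H (x (k0 + j)%N om) - x (k0 + j)%N om) - y) `^ p) <= C}.
Proof.
move=> Hy; have := ae_foralln (fun M => local_fejer_cvg y M Hy).
apply: filterS => om /(_ (Num.truncn (enorm (x k0 om - y))).+1); apply.
by rewrite ltW// truncnS_gt.
Qed.

End KrasnoselskiiMann.

(** Separability passes to subsets: for each rational centre and radius [1 / (m + 1)], a point of
    [F] in that ball is chosen when there is one, and [y0] otherwise. *)
Lemma fixed_points_dense_seq (R : realType) (n : nat) (F : set 'rV[R]_n) :
  F !=set0 -> exists ys : 'rV[rat]_n * nat -> 'rV[R]_n, (forall q, F (ys q)) /\
    forall y (e : R), F y -> 0 < e -> exists q, enorm (y - ys q) < e.
Proof.
move=> [y0 Fy0].
have /choice[ys hys] : forall q : 'rV[rat]_n * nat, exists y, F y /\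
    ((exists2 u, F u & enorm (u - map_mx ratr q.1) < q.2.+1%:R^-1) ->
     enorm (y - map_mx ratr q.1) < q.2.+1%:R^-1).
  move=> q; have [[u Fu hu]|no] := pselect
    (exists2 u, F u & enorm (u - map_mx ratr q.1) < q.2.+1%:R^-1).
    by exists u.
  by exists y0.
exists ys; split => [q|y e Fy e0]; first by case: (hys q).
have e2 : 0 < e / 2 by rewrite divr_gt0.
have [m _ /(_ m (leqnn m)) /= hm0] := near_infty_natSinv_lt (PosNum e2).
have hm : m.+1%:R^-1 < e / 2 := hm0.
have [|q hq] := rat_row_dense y m.+1%:R^-1; first by rewrite invr_gt0.
exists (q, m); have [_ h] := hys (q, m).
have /h/= {}h : exists2 u, F u & enorm (u - map_mx ratr q) < m.+1%:R^-1 by exists y.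
have := enormB_triangle y (map_mx ratr q) (ys (q, m)).
rewrite (enormC (map_mx ratr q)) => /le_lt_trans; apply.
by rewrite (splitr e); apply: ltrD; apply: lt_trans hm.
Qed.

Theorem theorem3 (R : realType) (n : nat) (p : R)
  (H : 'rV[R]_n -> 'rV[R]_n)
  (d : measure_display) (Omega : measurableType d) (P : probability Omega R)
  (x w : nat -> Omega -> 'rV[R]_n) (alpha : nat -> R) :
  1 < p <= 2 ->
  (forall y z, enorm (H y - H z) <= enorm (y - z)) ->
  (exists y, H y = y) ->
  (exists M : R, forall y, H y = y -> enorm y <= M) ->
  (forall i : 'I_n, measurable_fun setT (fun om => x 0%N om ord0 i)) ->
  (forall k om, x k.+1 om = x k om + alpha k *: (H (x k om) - x k om + w k om)) ->
  (forall k (i : 'I_n), P.-integrable setT (fun om => (w k om ord0 i)%:E)) ->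
  (forall k (i : 'I_n), exists Y : Omega -> R,
      is_cond_exp P (natural_filtration x k) (fun om => w k om ord0 i) Y /\
      {ae P, forall om, Y om = 0}) ->
  (exists xbar, H xbar = xbar /\ exists A B : R, 0 < A /\ 0 <= B /\
     forall k, exists Y : Omega -> \bar R,
       is_cond_exp_nneg P (natural_filtration x k)
         (fun om => enorm (w k om) `^ p) Y /\
       {ae P, forall om, (Y om <= (A + B * enorm (x k om - xbar) `^ p)%:E)%E}) ->
  (forall k, 0 < alpha k) ->
  (forall k, alpha k.+1 <= alpha k) ->
  [series alpha k]_k @ \oo --> +oo ->
  cvg ([series alpha k `^ p]_k @ \oo) ->
  {ae P, forall om, exists y, H y = y /\ (fun k => x k om) @ \oo --> y}.
Proof.
move=> p12 Hne Hfix _ mx0 xS iw w0 [xbar [_ [A [B [A0 [B0 wp]]]]]] a0 _ asum apsum.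
have p0 : 0 < p by case/andP: p12 => + _; apply: lt_trans.
have acvg := powR_summable_cvg0 _ _ _ p0 a0 apsum.
have [k0 _ hk0] : \forall k \near \oo, alpha k < 1.
  by move/cvgr_lt : acvg; apply.
have a1 j : alpha (k0 + j)%N <= 1 by apply/ltW/hk0/leq_addr.
have [ys [ysfix ysdense]] := fixed_points_dense_seq R n [set y | H y = y] Hfix.
(* The countable index type of [ys] lets one null set serve all the chosen fixed points. *)
have aeD : {ae P, forall om q,
    cvgn (fun j => enorm (x (k0 + j)%N om - ys q) `^ p) /\
    exists C : R, forall m, \sum_(j < m) (enorm (x (k0 + j)%N om - ys q) `^ p -
      enorm (x (k0 + j)%N om + alpha (k0 + j)%N *:
        (H (x (k0 + j)%N om) - x (k0 + j)%N om) - ys q) `^ p) <= C}.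
  apply: ae_forall_countType => q.
  exact: (fejer_cvg p H P x w alpha xbar A B p12 Hne mx0 xS iw w0 (ltW A0) B0
    wp a0 apsum k0 a1 (ys q) (ysfix q)).
apply: filterS aeD => om hom.
have shiftE (T : Type) (u : nat -> T) : (fun j => u (k0 + j)%N) = [sequence u (j + k0)%N]_j.
  by apply/funext => j; rewrite /= addnC.
have [||||||z [Hz hz]] := averaged_path_cvg p H p12 Hne (fun j => x (k0 + j)%N om)
  (fun j => alpha (k0 + j)%N) (range ys) Hfix (fun j => a0 (k0 + j)%N).
- by rewrite shiftE cvg_shiftn.
- apply/cvgryPge => r.
  (* Dropping the first [k0] terms preserves divergence: the full series is asked to exceed the
     target by the discarded head. *)
  have /cvgryPge/(_ (r + series alpha k0)) [N _ hN] := asum.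
  exists N => // m /= Nm; have /= := hN (k0 + m)%N (leq_trans Nm (leq_addl _ _)).
  have -> : series alpha (k0 + m) = series alpha k0 +
      series (fun j => alpha (k0 + j)%N) m.
    rewrite /series/= (big_cat_nat (n := k0)) ?leq_addr//=; congr (_ + _).
    rewrite -{1}[k0]add0n big_addn addKn.
    by apply: eq_bigr => i _; rewrite addnC.
  by rewrite addrC lerD2l.
- by move=> _ [q _ <-]; exact: ysfix.
- by move=> y e Hy e0; have [q hq] := ysdense y e Hy e0; exists (ys q) => //; exists q.
- by move=> _ [q _ <-]; have [] := hom q.
- by move=> _ [q _ <-]; have [] := hom q.
exists z; split => //.
have -> : ((fun k => x k om) @ \oo --> z) = ([sequence x (j + k0)%N om]_j @ \oo --> z).
  by rewrite -(cvg_shiftn k0).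
by move: hz; rewrite (shiftE _ (fun k => x k om)).
Qed.
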